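(* Let $M$ be a (pointed) metric space. The following assertions are equivalent. (1) $\mathcal{F}(M)$ is linearly isometric to a subspace of an $L_1$-space, i.e. of $L_1(\mu)$ for some measure $\mu$. (2) $M$ satisfies the four-point condition: for all $a,b,c,d\in M$, $$d(a,b)+d(c,d)\le \max\bigl(d(a,c)+d(b,d),\; d(a,d)+d(b,c)\bigr).$$ (3) $M$ isometrically embeds into an $\mathbb{R}$-tree.
   Context: All Banach spaces are real. For a pointed metric space $M$ (a metric space with a designated origin $0$), $\mathrm{Lip}_0(M)$ is the Banach space of all real-valued Lipschitz functions on $M$ vanishing at $0$, normed by the best Lipschitz constant $\|f\|=\inf\{K\in\mathbb{R} : |f(y)-f(x)|\le K\,d(x,y)\ \forall x,y\in M\}$. The Lipschitz-free space $\mathcal{F}(M)$ is the closed linear span in $\mathrm{Lip}_0(M)^*$ of the evaluation functionals $\delta_x: f\mapsto f(x)$, $x\in M$; it is a predual of $\mathrm{Lip}_0(M)$. Different choices of base point yield isometric Lipschitz-free spaces, so the choice of origin is irrelevant. An $\mathbb{R}$-tree is a metric space $T$ such that: (i) for any $a,b\in T$ there is a unique isometry $\phi$ of the closed interval $[0,d(a,b)]$ into $T$ with $\phi(0)=a$ and $\phi(d(a,b))=b$; (ii) any one-to-one continuous map $\varphi:[0,1]\to T$ has the same range as the isometry $\phi$ associated with the points $a=\varphi(0)$ and $b=\varphi(1)$. *)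

(* Defs.v *)
From HB Require Import structures.
From mathcomp Require Import all_boot all_order all_algebra.
From mathcomp Require Import all_classical all_reals all_analysis.

Set Implicit Arguments.
Unset Strict Implicit.
Unset Printing Implicit Defensive.
Import Order.TTheory GRing.Theory Num.Theory.
Import numFieldNormedType.Exports.

Local Open Scope classical_set_scope.
Local Open Scope ring_scope.

Section best_constant.
Context {R : realType} {I : Type} (w : I -> R).
Hypothesis w_ge0 : forall i, 0 <= w i.
Implicit Types (g h : I -> R) (K : R).

(* [0 <= K] only matters when [w = 0], where every real would be a bound. *)
Definition bounds g : set R :=
  [set K | 0 <= K /\ forall i, `|g i| <= K * w i].

Lemma has_inf_bounds g : bounds g !=set0 -> has_inf (bounds g).
Proof. by split=> //; exists 0 => K []. Qed.

Lemma inf_bounds_ge0 g : 0 <= inf (bounds g).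
Proof.
have [g0|/set0P/negP/negPn/eqP ->] := pselect (bounds g !=set0).
  by apply: lb_le_inf => // K [].
by rewrite inf0.
Qed.

Lemma inf_bounds_le g K : bounds g K -> inf (bounds g) <= K.
Proof. by move=> gK; apply: ge_inf => //; exists 0 => L []. Qed.

Lemma bounds_inf g : bounds g !=set0 -> bounds g (inf (bounds g)).
Proof.
move=> g0; split=> [|i]; first exact: inf_bounds_ge0.
have := w_ge0 i; rewrite le_eqVlt => /predU1P[wi|wi].
  by have [K [_ /(_ i)]] := g0; rewrite -wi !mulr0.
rewrite -ler_pdivrMr//; apply: lb_le_inf => // K [_ /(_ i)].
by rewrite ler_pdivrMr.
Qed.

Lemma boundsD g h K L : bounds g K -> bounds h L ->
  bounds (fun i => g i + h i) (K + L).
Proof.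
move=> [K0 gK] [L0 hL]; split=> [|i]; first exact: addr_ge0.
by rewrite mulrDl (le_trans (ler_normD _ _))// lerD.
Qed.

Lemma boundsZ a g K : bounds g K -> bounds (fun i => a * g i) (`|a| * K).
Proof.
move=> [K0 gK]; split=> [|i]; first exact: mulr_ge0.
by rewrite normrM -mulrA ler_wpM2l.
Qed.

Lemma ler_inf_boundsD g h : bounds g !=set0 -> bounds h !=set0 ->
  inf (bounds (fun i => g i + h i)) <= inf (bounds g) + inf (bounds h).
Proof.
by move=> /bounds_inf gb /bounds_inf hb; apply/inf_bounds_le/boundsD.
Qed.

Lemma inf_boundsZ a g : bounds g !=set0 ->
  inf (bounds (fun i => a * g i)) = `|a| * inf (bounds g).
Proof.
move=> g0; have gb := bounds_inf g0.
have agb := boundsZ a gb; apply/eqP; rewrite eq_le inf_bounds_le//=.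
have [->|a0] := eqVneq a 0; first by rewrite normr0 mul0r inf_bounds_ge0.
rewrite -ler_pdivlMl ?normr_gt0// -normfV; apply: inf_bounds_le.
have -> : g = (fun i => a^-1 * (a * g i)) by apply/funext => i; rewrite mulKf.
under [X in _ (inf (bounds X))]eq_fun do rewrite mulKf//.
by apply/boundsZ/bounds_inf; exists (`|a| * inf (bounds g)).
Qed.

Lemma inf_bounds_eq0 g : bounds g !=set0 -> inf (bounds g) = 0 ->
  forall i, g i = 0.
Proof.
move=> /bounds_inf[_ gb] g0 i; apply/eqP; rewrite -normr_le0.
by rewrite (le_trans (gb i))// g0 mul0r.
Qed.

End best_constant.


Section Lip0.
Context {R : realType} {M : metricType R}.
Implicit Types (o : M) (f g : M -> R).

(* [0 <= K] only matters when [M] is a single point, where every real number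
   would otherwise be a Lipschitz constant. *)
Definition lipschitz_constants f : set R :=
  [set K | 0 <= K /\ forall x y, `|f y - f x| <= K * mdist x y].

Lemma lipschitz_constantsE f : lipschitz_constants f =
  bounds (fun p => mdist p.1 p.2) (fun p : M * M => f p.2 - f p.1).
Proof.
apply/seteqP; split=> K [K0 fK]; split=> //.
by move=> x y; exact: (fK (x, y)).
Qed.

Definition Lip0_pred o : {pred M -> R} :=
  mem [set f | f o = 0 /\ lipschitz_constants f !=set0].

Lemma Lip0_submod_closed o : submod_closed (Lip0_pred o).
Proof.
split=> [|a f g].
  apply/mem_set; split=> //; exists 0; split=> // x y.
  by rewrite subrr normr0 mul0r.
move=> /set_mem[fo [K]]; rewrite lipschitz_constantsE => fK.
move=> /set_mem[go [L]]; rewrite lipschitz_constantsE => gL.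
apply/mem_set; split; first by rewrite /= !fctE fo go scaler0 addr0.
exists (`|a| * K + L); rewrite lipschitz_constantsE.
have := boundsD (boundsZ a fK) gL; congr (bounds _ _ _).
by apply/funext => p; rewrite !fctE mulrBr opprD addrACA.
Qed.

HB.instance Definition _ o :=
  GRing.isSubmodClosed.Build R (M -> R) (Lip0_pred o) (Lip0_submod_closed o).

Record Lip0 o := MkLip0 { Lip0_fun :> M -> R ; _ : Lip0_fun \in Lip0_pred o }.

HB.instance Definition _ o := [isSub for @Lip0_fun o].
HB.instance Definition _ o := gen_eqMixin (Lip0 o).
HB.instance Definition _ o := [Choice of Lip0 o by <:].
HB.instance Definition _ o := [SubChoice_isSubLmodule of Lip0 o by <:].

End Lip0.

Section Lip0_norm.
Context {R : realType} {M : metricType R} (o : M).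
Implicit Types f g : Lip0 o.

Definition lip_norm f : R := inf (lipschitz_constants f).

Let Lip0_bounds f :
  bounds (fun p => mdist p.1 p.2) (fun p : M * M => f p.2 - f p.1) !=set0.
Proof. by have /set_mem[_] := valP f; rewrite lipschitz_constantsE. Qed.

Let dist_ge0 (p : M * M) : 0 <= mdist p.1 p.2.
Proof. exact: mdist_ge0. Qed.

Let ler_lip_normD f g : lip_norm (f + g) <= lip_norm f + lip_norm g.
Proof.
rewrite /lip_norm !lipschitz_constantsE.
apply: le_trans (ler_inf_boundsD dist_ge0 (Lip0_bounds f) (Lip0_bounds g)).
rewrite le_eqVlt; apply/orP; left; apply/eqP; congr (inf (bounds _ _)).
by apply/funext => p; rewrite /= !fctE opprD addrACA.
Qed.

Let lip_normZ (a : R) f : lip_norm (a *: f) = `|a| * lip_norm f.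
Proof.
rewrite /lip_norm !lipschitz_constantsE -(inf_boundsZ dist_ge0)//.
congr (inf (bounds _ _)).
by apply/funext => p; rewrite /= !fctE mulrBr.
Qed.

Let lip_norm_eq0 f : lip_norm f = 0 -> f = 0.
Proof.
rewrite /lip_norm lipschitz_constantsE => f0; apply/val_inj/funext => x.
have := inf_bounds_eq0 dist_ge0 (Lip0_bounds f) f0 (o, x).
by have /set_mem[/= -> _] := valP f; rewrite subr0.
Qed.

HB.instance Definition _ :=
  Lmodule_isNormed.Build R (Lip0 o) ler_lip_normD lip_normZ lip_norm_eq0.

End Lip0_norm.

Section dual.
Context {R : realType} {V : normedModType R}.
Implicit Types phi psi : V -> R.

Definition dual_pred : {pred V -> R} :=
  mem [set phi | linear (phi : V -> R^o) /\ continuous phi].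

Lemma dual_submod_closed : submod_closed dual_pred.
Proof.
split=> [|a phi psi].
  apply/mem_set; split=> [b x y|x]; first by rewrite scaler0 addr0.
  exact: cst_continuous.
move=> /set_mem[phil phic] /set_mem[psil psic]; apply/mem_set; split.
  move=> b x y; rewrite !fctE phil psil !scalerDr addrACA; congr (_ + _ + _).
  by rewrite !scalerA mulrC.
move=> x; apply: (@continuousD _ R^o V (a *: phi) psi x); last exact: psic.
apply: continuousZl_tmp; exact: phic.
Qed.

HB.instance Definition _ :=
  GRing.isSubmodClosed.Build R (V -> R) dual_pred dual_submod_closed.

End dual.

Record dual {R : realType} (V : normedModType R) :=
  MkDual { dual_fun :> V -> R ; _ : dual_fun \in @dual_pred R V }.

Section dual_norm.
Context {R : realType} (V : normedModType R).
Implicit Types phi psi : dual V.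

HB.instance Definition _ := [isSub for @dual_fun R V].
HB.instance Definition _ := gen_eqMixin (dual V).
HB.instance Definition _ := [Choice of dual V by <:].
HB.instance Definition _ := [SubChoice_isSubLmodule of dual V by <:].

Definition dual_norm phi : R := inf (bounds (fun x : V => `|x|) phi).

Let dual_bounds phi : bounds (fun x : V => `|x|) phi !=set0.
Proof.
have /set_mem[phil phic] := valP phi.
pose L := GRing.isLinear.Build _ _ _ _ _ phil.
pose l : {linear V -> R^o} := HB.pack (phi : V -> R^o) L.
have lb := proj2 (linear_bounded_continuous l) phic.
have /pinfty_ex_gt0[K K0 lK] := proj1 (linear_boundedP l) lb.
by exists K; split=> //; exact: ltW.
Qed.

Let norm_ge0 (x : V) : 0 <= `|x|.
Proof. exact: normr_ge0. Qed.

Let ler_dual_normD phi psi :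
  dual_norm (phi + psi) <= dual_norm phi + dual_norm psi.
Proof.
exact: (ler_inf_boundsD norm_ge0 (dual_bounds phi) (dual_bounds psi)).
Qed.

Let dual_normZ (a : R) phi : dual_norm (a *: phi) = `|a| * dual_norm phi.
Proof. by rewrite /dual_norm -(inf_boundsZ norm_ge0 _ (dual_bounds phi)). Qed.

Let dual_norm_eq0 phi : dual_norm phi = 0 -> phi = 0.
Proof.
move=> phi0; apply/val_inj/funext => x.
exact: (inf_bounds_eq0 norm_ge0 (dual_bounds phi) phi0 x).
Qed.

HB.instance Definition _ :=
  Lmodule_isNormed.Build R (dual V) ler_dual_normD dual_normZ dual_norm_eq0.

End dual_norm.

Section closed_span.
Context {R : realType} {V : normedModType R}.
Implicit Types A : set V.

Definition linear_span A : set V :=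
  [set v | exists n (a : 'I_n -> R) (u : 'I_n -> V),
     (forall i, A (u i)) /\ v = \sum_(i < n) a i *: u i].

Definition closed_span A : {pred V} := mem (closure (linear_span A)).

Let linear_span_lin A a u v :
  linear_span A u -> linear_span A v -> linear_span A (a *: u + v).
Proof.
move=> [n [b [x [Ax ->]]]] [m [c [y [Ay ->]]]]; exists (n + m)%N.
exists (fun i : 'I_(n + m) => match fintype.split i with inl j => a * b j | inr k => c k end).
exists (fun i : 'I_(n + m) => match fintype.split i with inl j => x j | inr k => y k end).
split=> [i|]; first by case: splitP => j _; [exact: Ax|exact: Ay].
rewrite big_split_ord/= scaler_sumr; congr (_ + _); apply: eq_bigr => i _.
  by rewrite (unsplitK (inl i)) scalerA.
by rewrite (unsplitK (inr i)).
Qed.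

Lemma closed_span_submod_closed A : submod_closed (closed_span A).
Proof.
split=> [|a u v /set_mem uA /set_mem vA]; apply/mem_set.
  apply: subset_closure; exists 0%N, (fun=> 0), (fun=> 0).
  by split; [case|rewrite big_ord0].
move=> B /= nB.
have : (fun p : V * V => a *: p.1 + p.2) @ (u, v) --> a *: u + v.
  apply: cvgD; last exact: cvg_snd.
  by apply: cvgZl_tmp; exact: cvg_fst.
move=> /(_ _ nB)[[U W] /= [nU nW]] UWB.
have [x [Ax Ux]] := uA _ nU; have [y [Ay Wy]] := vA _ nW.
by exists (a *: x + y); split; [exact: linear_span_lin|exact: (UWB (x, y))].
Qed.

HB.instance Definition _ A :=
  GRing.isSubmodClosed.Build R V (closed_span A) (closed_span_submod_closed A).

End closed_span.

Section lipschitz_free.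
Context {R : realType} {M : metricType R} (o : M).

Let evaluation_dual (x : M) : (fun f : Lip0 o => f x) \in dual_pred.
Proof.
apply/mem_set; pose e : Lip0 o -> R^o := fun f => f x.
have elin : linear e by [].
pose L := GRing.isLinear.Build _ _ _ _ _ elin.
pose l : {linear Lip0 o -> R^o} := HB.pack e L.
split=> //; apply: (proj1 (linear_bounded_continuous l)).
apply/linear_boundedP; exists (mdist o x); split=> [|r /ltW xr f].
  exact: num_real.
have : lipschitz_constants f `|f|.
  rewrite lipschitz_constantsE; have /set_mem[_ f0] := valP f.
  rewrite /Num.norm/= /lip_norm lipschitz_constantsE; apply: bounds_inf => [p|].
    exact: mdist_ge0.
  by rewrite -lipschitz_constantsE.
move=> [_ /(_ o x)]; have /set_mem[/= -> _] := valP f; rewrite subr0.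
by move=> /le_trans; apply; rewrite mulrC ler_wpM2r.
Qed.

Definition evaluation (x : M) : dual (Lip0 o) := MkDual (evaluation_dual x).

Record lipschitz_free := MkLipschitzFree {
  lipschitz_free_val : dual (Lip0 o) ;
  _ : lipschitz_free_val \in closed_span (range evaluation) }.

HB.instance Definition _ := [isSub for lipschitz_free_val].
HB.instance Definition _ := gen_eqMixin lipschitz_free.
HB.instance Definition _ := [Choice of lipschitz_free by <:].
HB.instance Definition _ := [SubChoice_isSubLmodule of lipschitz_free by <:].

Let free_norm (m : lipschitz_free) : R := `|val m|.

Let ler_free_normD m n : free_norm (m + n) <= free_norm m + free_norm n.
Proof. exact: ler_normD. Qed.

Let free_normZ (a : R) m : free_norm (a *: m) = `|a| * free_norm m.
Proof. exact: normrZ. Qed.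

Let free_norm_eq0 m : free_norm m = 0 -> m = 0.
Proof. by move=> /normr0_eq0 m0; exact: val_inj. Qed.

HB.instance Definition _ := Lmodule_isNormed.Build R lipschitz_free
  ler_free_normD free_normZ free_norm_eq0.

End lipschitz_free.

Arguments lipschitz_free {R M} o.

(* Elements of [LspaceType1 mu] are classes of functions modulo equality
   [mu]-almost everywhere and coerce to a representative; the library does not
   provide the vector space structure, hence linearity is stated a.e. *)
Definition isometric_to_subspace_of_L1 {R : realType} (V : normedModType R) :=
  exists (d : measure_display) (T : measurableType d)
         (mu : {measure set T -> \bar R}) (J : V -> LspaceType1 mu),
    (forall (a : R) (u v : V),
       J (a *: u + v) = (fun t => a * J u t + J v t) %[ae mu]) /\
    (forall u : V, ('N[mu]_1[EFin \o J u])%E = `|u|%:E).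

Section metric.
Context {R : realType}.

Definition four_point_condition (M : metricType R) :=
  forall a b c d : M, mdist a b + mdist c d <=
    Num.max (mdist a c + mdist b d) (mdist a d + mdist b c).

Definition isometric_embedding (M T : metricType R) (j : M -> T) :=
  forall x y, mdist (j x) (j y) = mdist x y.

(* Maps defined on a closed interval are represented by total functions on [R]
   whose values outside the interval are irrelevant. *)
Definition segment_isometry (T : metricType R) (a b : T) (phi : R -> T) :=
  [/\ {in `[0, mdist a b] &, forall s t, mdist (phi s) (phi t) = `|s - t|},
      phi 0 = a & phi (mdist a b) = b].

Definition R_tree (T : metricType R) :=
  (forall a b : T, exists2 phi : R -> T, segment_isometry a b phi &
     forall psi, segment_isometry a b psi -> {in `[0, mdist a b], psi =1 phi}) /\
  (forall h : R -> T, {within `[0, 1], continuous h} ->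
     {in `[0, 1] &, injective h} ->
     forall phi, segment_isometry (h 0) (h 1) phi ->
       h @` `[0, 1] = phi @` `[0, mdist (h 0) (h 1)]).

End metric.

(* Main.v *)
From HB Require Import structures.
Require Import Defs.
From mathcomp Require Import all_boot all_order all_algebra generic_quotient.
From mathcomp Require Import all_classical all_reals all_analysis.
From mathcomp Require Import measurable_realfun.
From mathcomp Require Import ring lra.

(** Everything goes through the R-tree and its length measure.

    _Four points and trees._  For a base point [o], the four-point condition
    says that the Gromov product
    [gromov o x y = (d(o,x) + d(o,y) - d(x,y)) / 2] is an ultrametric
    similarity: [min (x|y) (y|z) <= (x|z)].  In an R-tree, [(x|y)] is the height
    at which the segments from [o] to [x] and to [y] separate, whence the
    ultrametric inequality ([segments_branch], [R_tree_four_point]).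
    Conversely, a segment of length [d(o,x)] is attached to [o] for each [x],
    and the segments of [x] and [y] are glued up to height [(x|y)]; the result
    is geodesic and still satisfies the four-point condition.  Such a space is
    an R-tree ([geodesic_four_point_R_tree]): a point of a segment separates
    its end points, so that a path from [a] to [b] covers the segment from [a]
    to [b], and an injective path cannot leave it.

    _From a tree to L1._  An R-tree carries a length measure, for which the
    segment [S x] from the root to [x] has measure [d(o,x)]
    ([exists_length_measure]).  The isometry sends [delta x] to the indicator
    of [S x].  That it preserves the norm of [\sum_k a_k delta x_k] is a duality
    statement.  On the one hand, if [h] is 1-Lipschitz on the tree, then
    [\sum_k a_k h(x_k)] is at most the L1 norm of [\sum_k a_k 1_(S x_k)]: the
    two points whose segments separate last are moved down to their branching
    point, which changes both sides by comparable amounts and leaves one point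
    less ([merge_norm], [lipschitz_combination_le]); Lipschitz functions on [M]
    extend to the tree.  On the other hand, integrating along segments the sign
    of [\sum_k a_k 1_(S x_k)] gives a 1-Lipschitz function for which equality
    holds ([combination_attained]).  The isometry extends to the whole free
    space by completeness of L1 ([dense_isometry_extends]).

    _From L1 to four points._  For real numbers,
    [|q+s| + |q-s| + 2|p| <= |p+q| + |p-q| + |p+s| + |p-s|], and the inequality
    passes to norms in L1 by integration.  Applied to the three ways of pairing
    [a, b, c, d], that is to [p = a+b-c-d], [q = a+c-b-d] and [s = a+d-b-c]
    (writing [x] for [delta x]), the norms are twice distances, except that
    of [p], which is at least
    [min (d(a,c)+d(b,d), d(a,d)+d(b,c))] ([norm_two_sources_two_sinks]); what
    remains is the four-point condition. *)

Set Implicit Arguments.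
Unset Strict Implicit.
Unset Printing Implicit Defensive.
Import Order.TTheory GRing.Theory Num.Theory.
Import numFieldNormedType.Exports.

Local Open Scope classical_set_scope.
Local Open Scope ring_scope.

(** * Four-point spaces and R-trees *)

Section four_point.
Context {R : realType} {T : metricType R}.
Implicit Types a b p q z w : T.

Definition between a p b := mdist a p + mdist p b = mdist a b.

Definition geodesic_space := forall a b (t : R), 0 <= t <= mdist a b ->
  exists2 p, mdist a p = t & between a p b.

Lemma four_pointP : four_point_condition T -> forall a b p q,
  mdist a b + mdist p q <= mdist a p + mdist b q \/
  mdist a b + mdist p q <= mdist a q + mdist b p.
Proof. by move=> T4 a b p q; apply/orP; rewrite -le_max; exact: T4. Qed.

Lemma between_inj : four_point_condition T -> forall a b p q,
  between a p b -> between a q b -> mdist a p = mdist a q -> p = q.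
Proof.
move=> /four_pointP T4 a b p q pab qab pq; apply: mdist_positivity.
have := T4 p q a b; rewrite /between in pab qab.
have := mdist_ge0 p q.
rewrite (metric_sym p a) (metric_sym q a).
by case; lra.
Qed.

(** Removing [p] from the segment from [a] to [b] separates [a] from [b]: a
    point [z] is on the side of [a] when its projection to the segment comes
    strictly before [p].  The signed distance to [p] is therefore continuous
    across the two sides. *)
Definition before a b p z := mdist a z - mdist z b < mdist a p - mdist p b.

Definition signed_dist a b p z : R :=
  if before a b p z then - mdist z p else mdist z p.

(** In a tree, [p] is a cut point: whatever joins the two sides goes through it.
    Here the two sides are told apart by the projections to the segment, and
    the distances to [p] are computed from those projections by the four-point
    condition. *)
Lemma between_sides : four_point_condition T -> forall a b p z w,
  between a p b -> before a b p z -> ~~ before a b p w -> between z p w.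
Proof.
move=> /four_pointP T4 a b p z w; rewrite /between /before -leNgt.
move=> pab za wb.
have := metric_triangle z p w.
have := T4 z p a b; have := T4 w p a b; have := T4 z b a w.
rewrite (metric_sym z a) (metric_sym p a) (metric_sym w a) (metric_sym p w).
rewrite (metric_sym b w) (metric_sym b a).
by move=> [?|?] [?|?] [?|?]; lra.
Qed.

Lemma signed_dist_lip : four_point_condition T -> forall a b p z w,
  between a p b ->
  `|signed_dist a b p z - signed_dist a b p w| <= mdist z w.
Proof.
move=> T4 a b p z w pab; have side := between_sides T4 pab.
have := metric_triangle z w p; have := metric_triangle w z p.
rewrite ler_norml /signed_dist (metric_sym w z).
have := mdist_ge0 z p; have := mdist_ge0 w p.
case: ifPn => za; case: ifPn => wa; try lra.
- by have := side _ _ za wa; rewrite /between (metric_sym p w); lra.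
- have := side _ _ wa za; rewrite /between (metric_sym p z) (metric_sym w z).
  lra.
Qed.

(** The intermediate value theorem for the signed distance to [p]. *)
Lemma path_meets_between : four_point_condition T ->
  forall (h : R -> T) (c e : R) p, c <= e ->
  {within `[c, e], continuous h} -> between (h c) p (h e) ->
  exists2 s, s \in `[c, e] & h s = p.
Proof.
move=> T4 h c e p ce hc pab.
pose F := signed_dist (h c) (h e) p.
have F_cont : continuous F.
  move=> z; apply/cvgrPdist_lt => eps eps0.
  near=> w; rewrite /F.
  apply: (le_lt_trans (signed_dist_lip T4 _ _ pab)).
  by near: w; have := nbhsx_ballx z eps eps0; rewrite ballEmdist.
have Fh_cont : {within `[c, e], continuous (F \o h)}.
  move=> x; apply: (@continuous_comp (subspace `[c, e]) T R h F x).
    exact: hc.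
  exact: F_cont.
have [|s sce Fs0] := IVT ce Fh_cont (v := 0).
  rewrite /= /F /signed_dist /before (metric_sym (h e) p) !mdistxx.
  move: pab; rewrite /between.
  have := mdist_ge0 (h c) p; have := mdist_ge0 p (h e).
  rewrite ge_min le_max => pe cp pab; rewrite sub0r subr0.
  apply/andP; split; apply/orP.
    by left; case: ifPn; rewrite -?leNgt; lra.
  by right; case: ifPn; rewrite -?leNgt; lra.
exists s => //; apply: mdist_positivity.
by move: Fs0; rewrite /= /F /signed_dist; case: ifPn; lra.
Unshelve. all: by end_near. Qed.

Lemma segment_isometry_between a b (phi : R -> T) t :
  segment_isometry a b phi -> 0 <= t <= mdist a b ->
  mdist a (phi t) = t /\ between a (phi t) b.
Proof.
move=> [iso phi0 phi1] t01; have /andP[t0 t1] := t01.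
have L0 := mdist_ge0 a b.
have at_ : mdist a (phi t) = t.
  by rewrite -[in LHS]phi0 iso ?in_itv/= ?lexx// sub0r normrN ger0_norm.
split=> //.
rewrite /between at_ -[X in mdist _ X]phi1 iso ?in_itv/= ?L0 ?lexx//.
by rewrite distrC ger0_norm ?subr_ge0// addrC subrK.
Qed.

End four_point.

Section geodesic_four_point.
Context {R : realType} {T : metricType R}.
Hypothesis T4 : four_point_condition T.
Hypothesis T_geo : geodesic_space (T := T).
Implicit Types a b p q z w : T.

Lemma geodesic_segment a b : exists phi : R -> T, segment_isometry a b phi.
Proof.
have /(_ _)/cid phiP t : exists p, 0 <= t <= mdist a b ->
    mdist a p = t /\ between a p b.
  have [/T_geo[p ap pab]|_] := boolP (0 <= t <= mdist a b).
    by exists p.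
  by exists a.
have L0 := mdist_ge0 a b.
exists (fun t => sval (phiP t)); split.
- move=> s t; rewrite !in_itv/= => s01 t01.
  have [] := svalP (phiP s) s01; have [] := svalP (phiP t) t01.
  set p := sval (phiP s); set q := sval (phiP t); rewrite /between.
  move=> aq qb ap pb; have := four_pointP T4 p q a b.
  have := metric_triangle a p q; have := metric_triangle a q p.
  rewrite (metric_sym q p) (metric_sym p a) (metric_sym q a).
  by case: (ger0P (s - t)) => st ? ? [?|?]; lra.
- have [|+ _] := svalP (phiP 0); first by rewrite lexx.
  by move/mdist_positivity => <-.
- have [|+] := svalP (phiP (mdist a b)); first by rewrite lexx L0.
  rewrite /between => -> /eqP; rewrite -subr_eq0 addrC addKr => /eqP.
  by move/mdist_positivity.
Qed.

(** An injective path makes no excursion out of the segment: leaving it at [q],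
    it would have to come back through [q]. *)
Lemma arc_is_segment (h : R -> T) : {within `[0, 1], continuous h} ->
  {in `[0, 1] &, injective h} -> forall s, s \in `[0, 1] ->
  between (h 0) (h s) (h 1).
Proof.
move=> hc hi s s01; have /andP[s0 s1] : 0 <= s <= 1 by rewrite in_itv in s01.
pose a := h 0; pose b := h 1; pose z := h s.
(* the projection of [z] to the segment is at distance [r] from [a] *)
pose r := (mdist a z + mdist a b - mdist z b) / 2.
have zab := metric_triangle a z b; have abz := metric_triangle a b z.
have baz := metric_triangle b a z.
rewrite (metric_sym b a) in baz; rewrite !(metric_sym b z) in baz abz.
have rab : 0 <= r <= mdist a b by rewrite /r; lra.
have [q aq qab] := T_geo rab.
have zq_dist : mdist q z = (mdist a z + mdist z b - mdist a b) / 2.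
  have := metric_triangle a q z; have := metric_triangle z q b.
  have := four_pointP T4 q z a b; move: qab; rewrite /between.
  rewrite (metric_sym q a) (metric_sym z a) (metric_sym z q) /r in aq *.
  by move=> ? [?|?] ? ?; lra.
have aqz : between a q z by rewrite /between zq_dist aq /r; lra.
have zqb : between z q b.
  by move: qab; rewrite /between (metric_sym z q) zq_dist aq /r; lra.
have [t1 t1_in ht1] : exists2 u, u \in `[0, s] & h u = q.
  apply: (path_meets_between T4 s0) => //.
  by apply: continuous_subspaceW hc; apply: subset_itvl; rewrite bnd_simp.
have [t2 t2_in ht2] : exists2 u, u \in `[s, 1] & h u = q.
  apply: (path_meets_between T4 s1) => //.
  by apply: continuous_subspaceW hc; apply: subset_itvr; rewrite bnd_simp.
move: t1_in t2_in; rewrite !in_itv/= => /andP[t1_ge0 t1s] /andP[st2 t2_le1].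
have s12 : t1 = t2.
  apply: hi; rewrite ?ht1 ?ht2// in_itv/=.
    by rewrite t1_ge0 (le_trans t1s).
  by rewrite t2_le1 (le_trans s0).
have -> : s = t1 by apply/eqP; rewrite eq_le t1s s12 st2.
by rewrite ht1.
Qed.

Lemma geodesic_four_point_R_tree : R_tree T.
Proof.
split=> [a b|h hc hi phi phiP].
  have [phi phiP] := geodesic_segment a b; exists phi => // psi psiP t.
  rewrite in_itv/= => t01.
  have [apsi psib] := segment_isometry_between psiP t01.
  have [aphi phib] := segment_isometry_between phiP t01.
  by apply: (between_inj T4 psib phib); rewrite apsi aphi.
apply/seteqP; split=> [_ [s s01 <-]|_ [t t01 <-]].
  have hs := arc_is_segment hc hi s01.
  exists (mdist (h 0) (h s)).
    have := mdist_ge0 (h 0) (h s); have := mdist_ge0 (h s) (h 1).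
    by move: hs; rewrite /between /= in_itv/=; lra.
  have t01 : 0 <= mdist (h 0) (h s) <= mdist (h 0) (h 1).
    have := mdist_ge0 (h 0) (h s); have := mdist_ge0 (h s) (h 1).
    by move: hs; rewrite /between; lra.
  have [aphi phib] := segment_isometry_between phiP t01.
  exact: (between_inj T4 phib hs).
move: t01; rewrite /= in_itv/= => t01.
have [aphi phib] := segment_isometry_between phiP t01.
have [s s01 hs] := path_meets_between T4 ler01 hc phib.
by exists s.
Qed.

End geodesic_four_point.

Section R_tree_four_point.
Context {R : realType} {T : metricType R}.
Implicit Types a b x y : T.

Lemma lipschitz_within_continuous (h : R -> T) (A : set R) (L : R) :
  {in A &, forall s t, mdist (h s) (h t) <= L * `|s - t|} ->
  {within A, continuous h}.
Proof.
move=> hL; apply/subspace_continuousP => s As; apply/cvg_ballP => eps eps0.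
have L0 : 0 < `|L| + 1 by rewrite ltr_wpDl.
rewrite near_withinE; near=> t => At; rewrite ballEmdist/=.
apply: le_lt_trans (hL _ _ (mem_set As) (mem_set At)) _.
apply: (@le_lt_trans _ _ ((`|L| + 1) * `|s - t|)).
  by rewrite ler_wpM2r// (le_trans (ler_norm L))// lerDl.
rewrite mulrC -ltr_pdivlMr//; near: t.
have := nbhsx_ballx s (eps / (`|L| + 1)); apply; exact: divr_gt0.
Unshelve. all: by end_near. Qed.

Lemma segment_dist a b (phi : R -> T) s t : segment_isometry a b phi ->
  0 <= s <= mdist a b -> 0 <= t <= mdist a b ->
  mdist (phi s) (phi t) = `|s - t|.
Proof. by move=> [iso _ _] sab tab; rewrite iso// in_itv. Qed.

Hypothesis T_tree : R_tree T.

(** Both initial pieces are the unique segment from [o] to the common point. *)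
Lemma segments_agree_below o x y phi psi t :
  segment_isometry o x phi -> segment_isometry o y psi ->
  0 <= t <= mdist o x -> t <= mdist o y -> phi t = psi t ->
  forall s, 0 <= s <= t -> phi s = psi s.
Proof.
move=> phiP psiP tx ty eq_t s st.
have [ot _] := segment_isometry_between phiP tx.
have /andP[t0 tx'] := tx.
have [chi chiP chi_uniq] := T_tree.1 o (phi t).
have sub c z eta : segment_isometry o z eta -> eta t = c -> mdist o c = t ->
    t <= mdist o z -> segment_isometry o c eta.
  move=> [iso eta0 eta1] etac oc tz; split; rewrite ?oc//.
  move=> u v /=; rewrite !in_itv/= => /andP[u0 ut] /andP[v0 vt].
  by apply: iso; rewrite in_itv/= ?u0 ?v0 (le_trans _ tz).
have := chi_uniq _ (sub _ _ _ phiP erefl ot tx') s.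
have := chi_uniq _ (sub _ _ _ psiP (esym eq_t) ot ty) s.
by rewrite ot in_itv/= st => -> // ->.
Qed.

(** The segments from [o] to [x] and [y] agree up to some [m] and then separate
    for good; going down to [phi m] along one and up along the other is an arc,
    so [phi m] lies between [x] and [y]. *)
Lemma segments_branch o x y phi psi :
  segment_isometry o x phi -> segment_isometry o y psi ->
  exists m, [/\ mdist x y = mdist o x + mdist o y - 2 * m,
    0 <= m <= mdist o x, m <= mdist o y, phi m = psi m &
    forall t, 0 <= t <= mdist o x -> t <= mdist o y -> phi t = psi t -> t <= m].
Proof.
move=> phiP psiP.
have ox0 := mdist_ge0 o x; have oy0 := mdist_ge0 o y.
pose E := [set t | [/\ 0 <= t <= mdist o x, t <= mdist o y & phi t = psi t]].
have E0 : E 0.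
  by split; rewrite ?lexx//; have [_ -> _] := phiP; have [_ -> _] := psiP.
have Esup : has_sup E.
  by split; [exists 0|exists (mdist o x) => t [/andP[]]].
pose m := sup E.
have Em t : E t -> t <= m by apply: sup_upper_bound.
have m0 : 0 <= m by exact: Em.
have mx : m <= mdist o x by apply: ge_sup; [exists 0|move=> t [/andP[]]].
have my : m <= mdist o y by apply: ge_sup; [exists 0|move=> t []].
have m0x : 0 <= m <= mdist o x by rewrite m0.
have m0y : 0 <= m <= mdist o y by rewrite m0.
have phim : phi m = psi m.
  apply: mdist_positivity; apply/eqP; rewrite eq_le mdist_ge0 andbT.
  apply/ler_addgt0Pl => e e0.
  have e20 : 0 < e / 2 by rewrite divr_gt0.
  have [t [tx ty tE] mt] := sup_adherent e20 Esup.
  have tm : t <= m by apply: Em.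
  have t0y : 0 <= t <= mdist o y by rewrite ty andbT; case/andP: tx.
  have := metric_triangle (phi m) (phi t) (psi m).
  rewrite {2}tE (segment_dist phiP)// (segment_dist psiP)//.
  rewrite -/m in mt; rewrite ger0_norm ?subr_ge0// ler0_norm ?subr_le0//; lra.
exists m; split => //; last first.
  by move=> t tx ty tE; apply: Em; split.
clearbody m.
have [L LE] : exists L, L = mdist o x + mdist o y - 2 * m by eexists.
have [L0|L0] := eqVneq L 0.
  have [_ _ phi1] := phiP; have [_ _ psi1] := psiP.
  have xm : mdist o x = m by lra.
  have ym : mdist o y = m by lra.
  have -> : x = y by rewrite -phi1 -psi1 xm ym phim.
  by rewrite mdistxx ym; lra.
have {}L0 : 0 < L by rewrite lt_neqAle eq_sym L0/= LE; lra.
(* down to [phi m], then up, at constant speed [L] on [[0, 1]] *)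
pose h s := if s * L <= mdist o x - m then phi (mdist o x - s * L)
            else psi (2 * m - mdist o x + s * L).
have sL s : s \in `[0, 1] -> 0 <= s * L <= L.
  rewrite in_itv/= => /andP[s0 s1].
  by rewrite mulr_ge0 ?(ltW L0)//= ler_piMl ?(ltW L0).
have h_lip : {in `[0, 1]%classic &, forall s t,
    mdist (h s) (h t) <= L * `|s - t|}.
  move=> s t; rewrite !inE => /sL sL01.
  move=> /sL tL01.
  have -> : L * `|s - t| = `|s * L - t * L|.
    by rewrite -mulrBl normrM (gtr0_norm L0) mulrC.
  rewrite /h; case: ifPn; rewrite -?ltNge => sm; case: ifPn;
    rewrite -?ltNge => tm.
  - rewrite (segment_dist phiP); [|lra..].
    by rewrite distrC opprB addrC subrKA.
  - apply: (le_trans (metric_triangle _ (phi m) _)); rewrite {2}phim.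
    rewrite (segment_dist phiP) ?(segment_dist psiP); [|lra..].
    rewrite [`|_ - m|]ger0_norm; last lra.
    rewrite [`|m - _|]ler0_norm; last lra.
    by rewrite ler0_norm; lra.
  - apply: (le_trans (metric_triangle _ (phi m) _)); rewrite {1}phim.
    rewrite (segment_dist phiP) ?(segment_dist psiP); [|lra..].
    rewrite [`|_ - m|]ger0_norm; last lra.
    rewrite [`|m - _|]ler0_norm; last lra.
    by rewrite ger0_norm; lra.
  - rewrite (segment_dist psiP); [|lra..].
    by rewrite opprD addrACA subrr add0r.
have h_inj : {in `[0, 1] &, injective h}.
  suff cross s t : s \in `[0, 1] -> t \in `[0, 1] ->
      s * L <= mdist o x - m -> mdist o x - m < t * L -> h s <> h t.
    move=> s t s01 t01.
    have [sm|sm] := leP (s * L) (mdist o x - m);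
      have [tm|tm] := leP (t * L) (mdist o x - m).
    - rewrite /h sm tm => hst; have := mdistxx (phi (mdist o x - s * L)).
      have := sL _ s01; have := sL _ t01 => ? ?.
      rewrite {2}hst (segment_dist phiP); [|lra..].
      move=> /normr0_eq0 stL; apply: (mulIf (lt0r_neq0 L0)); lra.
    - by move=> /(cross s t s01 t01 sm tm).
    - by move=> /esym /(cross t s t01 s01 tm sm).
    - rewrite /h leNgt sm leNgt tm /= => hst.
      have := mdistxx (psi (2 * m - mdist o x + s * L)).
      have := sL _ s01; have := sL _ t01 => ? ?.
      rewrite {2}hst (segment_dist psiP); [|lra..].
      move=> /normr0_eq0 stL; apply: (mulIf (lt0r_neq0 L0)); lra.
  move=> /sL sL01 /sL tL01 sm tm.
  rewrite /h sm leNgt tm/= => hst.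
  have [|ophi _] := segment_isometry_between (t := mdist o x - s * L) phiP.
    lra.
  have [|opsi _] :=
    segment_isometry_between (t := 2 * m - mdist o x + t * L) psiP.
    lra.
  have st : mdist o x - s * L = 2 * m - mdist o x + t * L.
    by rewrite -ophi hst opsi.
  suff : mdist o x - s * L <= m by lra.
  by apply: Em; split; [lra|lra|rewrite {2}st].
have h_cont := lipschitz_within_continuous h_lip.
have [h0 h1] : h 0 = x /\ h 1 = y.
  have [_ _ phi1] := phiP; have [_ _ psi1] := psiP.
  split; first by rewrite /h mul0r subr_ge0 mx subr0.
  rewrite /h mul1r; case: ifPn => Lm.
    have ym : m = mdist o y by lra.
    by rewrite -[RHS]psi1 -ym -phim; congr phi; lra.
  by rewrite -[RHS]psi1; congr psi; lra.
have [chi chiP _] := T_tree.1 (h 0) (h 1).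
have := T_tree.2 _ h_cont h_inj _ chiP; rewrite h0 h1 => hchi.
have : (chi @` `[0, mdist x y]) (phi m).
  rewrite -hchi; exists ((mdist o x - m) / L) => /=.
    rewrite in_itv/= divr_ge0 ?(ltW L0) ?subr_ge0//=.
    by rewrite ler_pdivrMr// mul1r; lra.
  by rewrite /h divfK ?gt_eqF// lexx opprB addrC subrK.
rewrite h0 h1 in chiP.
move=> [t /=]; rewrite in_itv/= => t01 chit.
have [_] := segment_isometry_between chiP t01.
rewrite chit /between => <-; rewrite {2}phim.
have [_ _ phi1] := phiP; have [_ _ psi1] := psiP.
rewrite -[in mdist x _]phi1 -[in mdist _ y]psi1.
rewrite (segment_dist phiP) ?(segment_dist psiP) ?lexx ?ox0 ?oy0//.
by rewrite ger0_norm ?subr_ge0// ler0_norm ?subr_le0//; lra.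
Qed.

(** Two segments that both agree with a third one up to some height agree with
    each other up to that height: the separation heights are ultrametric. *)
Lemma R_tree_four_point : four_point_condition T.
Proof.
move=> x y z o; rewrite le_max.
have [phi phiP _] := T_tree.1 o x; have [psi psiP _] := T_tree.1 o y.
have [chi chiP _] := T_tree.1 o z.
have [m [-> mx my _ m_max]] := segments_branch phiP psiP.
have [n [-> nx nz phichi _]] := segments_branch phiP chiP.
have [p [-> py pz psichi _]] := segments_branch psiP chiP.
rewrite (metric_sym z o) (metric_sym y o) (metric_sym x o).
suff : Num.min n p <= m by rewrite ge_min => /orP[?|?]; apply/orP; lra.
have [n0 p0] : 0 <= n /\ 0 <= p by split; lra.
have np : 0 <= Num.min n p by rewrite le_min n0.
apply: m_max.
- by rewrite np ge_min; case/andP: nx => _ ->.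
- by rewrite ge_min; case/andP: py => _ ->; rewrite orbT.
- rewrite (segments_agree_below phiP chiP nx nz phichi) ?np ?ge_min ?lexx//.
  rewrite (segments_agree_below psiP chiP py pz psichi) ?np ?ge_min ?lexx//.
  by rewrite orbT.
Qed.

End R_tree_four_point.

(** * Embedding a four-point space in an R-tree *)

Section metric_quotient.
Local Open Scope quotient_scope.

Lemma metric_quotient (R : realType) (P : choiceType) (D : P -> P -> R) :
  (forall p, D p p = 0) -> (forall p q, D p q = D q p) ->
  (forall q p r, D p r <= D p q + D q r) ->
  exists (T : metricType R) (f : P -> T),
    (forall u, exists p, f p = u) /\ forall p q, mdist (f p) (f q) = D p q.
Proof.
move=> D0 Dsym Dtri.
have D_ge0 p q : 0 <= D p q by have := Dtri q p p; rewrite D0 (Dsym q p); lra.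
pose e p q := D p q == 0.
have e_refl : reflexive e by move=> p; rewrite /e D0.
have e_sym : symmetric e by move=> p q; rewrite /e Dsym.
have e_trans : transitive e.
  move=> q p r /eqP pq /eqP qr; apply/eqP.
  by have := Dtri q p r; have := D_ge0 p r; lra.
pose E := EquivRel e e_refl e_sym e_trans.
pose dist (u v : {eq_quot E}) := D (repr u) (repr v).
have dist0 u : dist u u = 0 by exact: D0.
have dist_eq0 u v : dist u v = 0 -> u = v.
  move=> uv; rewrite -[u]reprK -[v]reprK; apply/eqP; rewrite eqmodE.
  by rewrite /=/e; apply/eqP.
have dist_sym u v : dist u v = dist v u by exact: Dsym.
have dist_tri v u w : dist u w <= dist u v + dist v w by exact: Dtri.
pose T : metricType R := HB.pack {eq_quot E} (@isMetric.Build R {eq_quot E} dist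
  dist0 dist_eq0 dist_sym dist_tri).
exists T, (fun p => (\pi_{eq_quot E} p)%qT : T); split.
  by move=> u; exists (repr (u : {eq_quot E})); exact: reprK.
have Drepr p : D p (repr (\pi_{eq_quot E} p)%qT) = 0.
  by apply/eqP; have : (p == repr (\pi_{eq_quot E} p) %[mod {eq_quot E}])%qT;
    [rewrite reprK|rewrite eqmodE].
move=> p q; rewrite -[LHS]/(D (repr _) (repr _)).
have := Drepr q; set q' := repr _; have := Drepr p; set p' := repr _ => pp' qq'.
have := Dtri p' p q; have := Dtri q' p' q; have := Dtri p p' q'.
have := Dtri q p q'; rewrite (Dsym p' p) (Dsym q' q); lra.
Qed.

End metric_quotient.

Section gromov_product.
Context {R : realType} {T : metricType R}.
Implicit Types o x y z : T.

Definition gromov o x y : R := (mdist o x + mdist o y - mdist x y) / 2.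

Lemma gromovxx o x : gromov o x x = mdist o x.
Proof. by rewrite /gromov mdistxx; lra. Qed.

Lemma gromovC o x y : gromov o x y = gromov o y x.
Proof. by rewrite /gromov (metric_sym x y); lra. Qed.

Lemma gromov_ge0 o x y : 0 <= gromov o x y.
Proof.
have := metric_triangle x o y; rewrite /gromov (metric_sym x o); lra.
Qed.

Lemma gromov_le o x y : gromov o x y <= mdist o x.
Proof. by rewrite /gromov; have := metric_triangle o x y; lra. Qed.

Lemma gromov_ultra : four_point_condition T -> forall o y x z,
  Num.min (gromov o x y) (gromov o y z) <= gromov o x z.
Proof.
move=> T4 o y x z; rewrite ge_min /gromov.
have := four_pointP T4 x z o y.
rewrite (metric_sym x o) (metric_sym z o) (metric_sym z y).
by case=> ?; apply/orP; lra.
Qed.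

End gromov_product.

(** [G p p] plays the role of the distance from [p] to a root, and [G p q] that
    of the height at which [p] and [q] branch. *)
Section ultrametric_product.
Context {R : realType} {P : Type} (G : P -> P -> R).
Hypothesis GC : forall p q, G p q = G q p.
Hypothesis G_ultra : forall q p r, Num.min (G p q) (G q r) <= G p r.

Definition tree_dist p q := G p p + G q q - 2 * G p q.

Lemma tree_dist0 p : tree_dist p p = 0.
Proof. by rewrite /tree_dist; lra. Qed.

Lemma tree_distC p q : tree_dist p q = tree_dist q p.
Proof. by rewrite /tree_dist (GC q p); lra. Qed.

Lemma tree_dist_four a b c d : tree_dist a b + tree_dist c d <=
  Num.max (tree_dist a c + tree_dist b d) (tree_dist a d + tree_dist b c).
Proof.
rewrite /tree_dist le_max; apply/orP.
have := G_ultra c a b; have := G_ultra d a b.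
have := G_ultra a c d; have := G_ultra b c d.
rewrite !ge_min (GC c b) (GC d b) (GC c a).
by move=> /orP[?|?] /orP[?|?] /orP[?|?] /orP[?|?]; lra.
Qed.

Lemma tree_dist_triangle q p r : tree_dist p r <= tree_dist p q + tree_dist q r.
Proof.
have := tree_dist_four p r q q; rewrite tree_dist0 addr0 => /le_trans; apply.
by rewrite (tree_distC r q) ge_max lexx.
Qed.

End ultrametric_product.

Section tree_of_four_point.
Context {R : realType} {M : metricType R} (o : M).
Hypothesis M4 : four_point_condition M.

(** The pair [(x, t)] stands for the point at height [t] of a segment that goes
    from [o] to [x].  Truncating the heights outside of [[0, mdist o x]] makes
    every pair meaningful; the pairs standing for the same point of the tree
    are the ones at distance zero from each other. *)
Definition branch_gromov (p q : M * R) : R :=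
  Num.max 0 (Num.min (Num.min p.2 q.2) (gromov o p.1 q.1)).

Local Notation G := branch_gromov.

Let GC p q : G p q = G q p.
Proof. by rewrite /G gromovC (minC p.2). Qed.

Let G_ge0 p q : 0 <= G p q.
Proof. by rewrite /G le_max lexx. Qed.

Let G_le p q : G p q <= G p p.
Proof.
rewrite /G; apply: le_max2 => //; rewrite minxx gromovxx.
by apply: le_min2; [rewrite ge_min lexx|exact: gromov_le].
Qed.

Let G_ultra q p r : Num.min (G p q) (G q r) <= G p r.
Proof.
rewrite /G -max_minr; apply: le_max2 => //.
have := gromov_ultra M4 o q.1 p.1 r.1; rewrite !le_min !ge_min => ultra.
apply/andP; split; first by rewrite !lexx !orbT.
by case/orP: ultra => ->; rewrite !orbT.
Qed.

Let embed x : M * R := (x, mdist o x).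

Let G_embed x y : G (embed x) (embed y) = gromov o x y.
Proof.
rewrite /G /= min_r; last by rewrite le_min gromov_le gromovC gromov_le.
by rewrite max_r// gromov_ge0.
Qed.

Let G_truncate x s t : 0 <= s <= G (x, t) (x, t) ->
  G (x, s) (x, s) = s /\ G (x, s) (x, t) = s.
Proof.
rewrite /G /= !minxx gromovxx => /andP[s_ge0 st].
have [->|s_neq0] := eqVneq s 0.
  rewrite (min_l (mdist_ge0 _ _)) maxxx; split=> //.
  by rewrite max_l// !ge_min lexx.
have s0 : 0 < s by rewrite lt_neqAle eq_sym s_neq0 s_ge0.
move: st; rewrite le_max leNgt s0/= le_min => /andP[st sx].
by rewrite (min_l sx) (min_l st) (min_l sx) max_r// ltW.
Qed.

(** Moving from [p] down to the height at which [q] leaves its branch does not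
    change the branching height with [q]. *)
Let G_descend p q s : G p q <= s <= G p p ->
  [/\ G (p.1, s) (p.1, s) = s, G (p.1, s) p = s & G (p.1, s) q = G p q].
Proof.
case: p => x t /andP[qs sp].
have [|zz zp] := @G_truncate x s t.
  by rewrite sp (le_trans (G_ge0 _ _) qs).
split=> //=; apply/eqP; rewrite eq_le; apply/andP; split.
  have := G_ultra (x, s) (x, t) q; rewrite GC zp ge_min.
  by case/orP=> // /(le_trans _) -> //; rewrite -{2}zz.
by have := G_ultra (x, t) (x, s) q; rewrite zp min_r.
Qed.

Theorem four_point_embeds_in_R_tree : exists (T : metricType R) (j : M -> T),
  R_tree T /\ isometric_embedding j.
Proof.
have [T [f [f_surj fD]]] := metric_quotient (tree_dist0 G) (tree_distC GC)
  (tree_dist_triangle GC G_ultra).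
have T4 : four_point_condition T.
  move=> a b c d; have [p <-] := f_surj a; have [q <-] := f_surj b.
  have [r <-] := f_surj c; have [s <-] := f_surj d.
  by rewrite !fD; exact: tree_dist_four.
exists T, (f \o embed); split; last first.
  move=> x y; rewrite /= fD /tree_dist !G_embed !gromovxx /gromov; lra.
apply: geodesic_four_point_R_tree => // a b t.
have [p <-] := f_surj a; have [q <-] := f_surj b; rewrite fD => /andP[t0 tD].
have Gpq := G_le p q; have Gqp := G_le q p; rewrite (GC q p) in Gqp.
move: tD; rewrite /tree_dist => tD.
have [tp|tp] := leP t (G p p - G p q).
  have [|zz zp zq] := @G_descend p q (G p p - t); first lra.
  exists (f (p.1, G p p - t)); rewrite /between !fD /tree_dist (GC p) zz zp ?zq.
    by lra.
  by lra.
(* the height reached by going down from [p] to the branching point, then up *)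
have [|zz zq] := @G_descend q p (2 * G p q - G p p + t); rewrite (GC q p).
  lra.
move=> zp.
exists (f (q.1, 2 * G p q - G p p + t));
  by rewrite /between !fD /tree_dist (GC p (q.1, _)) zz zp ?zq; lra.
Qed.

End tree_of_four_point.

(** * The length measure of a rooted tree *)

Section rooted_segments.
Context {R : realType} {T : metricType R} (r : T).
Implicit Types p q u z : T.

Definition root_segment p : set T := [set z | between r z p].

Lemma root_segmentP p z : root_segment p z <-> mdist r z <= gromov r z p.
Proof.
rewrite /root_segment /between/= /gromov; have := metric_triangle r z p.
by split; lra.
Qed.

Lemma root_segment_le p z : root_segment p z -> mdist r z <= mdist r p.
Proof. by rewrite /root_segment /between/=; have := mdist_ge0 z p; lra. Qed.

Hypothesis T4 : four_point_condition T.

Lemma root_segment_subset p u : root_segment p u ->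
  root_segment u `<=` root_segment p.
Proof.
move=> up z zu; have /root_segmentP zu' := zu; have /root_segmentP up' := up.
apply/root_segmentP; apply: le_trans (gromov_ultra T4 r u z p).
by rewrite le_min zu' (le_trans (root_segment_le zu) up').
Qed.

Lemma root_segment_inj p z w : root_segment p z -> root_segment p w ->
  mdist r z = mdist r w -> z = w.
Proof. exact: between_inj. Qed.

Lemma root_segmentI p q m : mdist r m = gromov r p q -> root_segment p m ->
  root_segment q m -> root_segment p `&` root_segment q = root_segment m.
Proof.
move=> mpq mp mq; apply/seteqP; split=> [z [zp zq]|z zm].
  have /root_segmentP zp' := zp; have /root_segmentP zq' := zq.
  have /root_segmentP mp' := mp.
  have zm : mdist r z <= mdist r m.
    rewrite mpq; apply: le_trans (gromov_ultra T4 r z p q).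
    by rewrite le_min zq' gromovC zp'.
  apply/root_segmentP; apply: le_trans (gromov_ultra T4 r p z m).
  by rewrite le_min zp' (le_trans zm)// gromovC.
split; [exact: root_segment_subset mp _ zm|].
exact: root_segment_subset mq _ zm.
Qed.

Hypothesis T_geo : geodesic_space (T := T).

Lemma exists_meet p q : exists m, [/\ mdist r m = gromov r p q,
  root_segment p m & root_segment q m].
Proof.
have [|m mpq mp] := T_geo (a := r) (b := p) (t := gromov r p q).
  by rewrite gromov_ge0 gromov_le.
exists m; split => //; apply/root_segmentP.
apply: le_trans (gromov_ultra T4 r p m q).
by rewrite le_min ((root_segmentP p m).1 mp)/= mpq lexx.
Qed.

Definition point_at p (t : R) : T :=
  xget r [set z | root_segment p z /\ mdist r z = t].

Lemma point_atP p t : 0 <= t <= mdist r p ->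
  root_segment p (point_at p t) /\ mdist r (point_at p t) = t.
Proof.
move=> tp; have [z zt zp] := T_geo tp.
by rewrite /point_at; case: xgetP => [? _ //|/(_ z)[]].
Qed.

Lemma point_at_segment p q t : 0 <= t <= mdist r q ->
  root_segment p (point_at q t) ->
  t <= mdist r p /\ point_at p t = point_at q t.
Proof.
move=> tq qp; have [q't tE] := point_atP tq.
have tp : t <= mdist r p by rewrite -tE root_segment_le.
have [|p't tE'] := @point_atP p t; first by rewrite tp andbT; case/andP: tq.
by split => //; apply: root_segment_inj p't qp _; rewrite tE'.
Qed.

End rooted_segments.

Section small_sets.
Context {R : realType} {T : metricType R} (r : T).
Implicit Types (p q : T) (A B : set T).

(** Arc length identifies the segment from the root to [p] with a real interval,
    where Lebesgue measure is available. *)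
Definition trace p A : set (measurableTypeR R) :=
  [set t : R | 0 <= t <= mdist r p /\ A (point_at r p t)].

Lemma trace0 p : trace p set0 = set0.
Proof. by apply/seteqP; split=> t []. Qed.

Lemma traceI p A B : trace p (A `&` B) = trace p A `&` trace p B.
Proof. by apply/seteqP; split=> [t [? []]|t [[? ?] []]]. Qed.

Lemma traceD p A B : trace p (A `\` B) = trace p A `\` trace p B.
Proof.
apply/seteqP; split=> [t [tp [At NBt]]|t [[tp At] NBt]].
  by split=> // -[].
by split=> //; split=> // Bt; apply: NBt.
Qed.

Lemma trace_bigcup p (F : (set T)^nat) :
  trace p (\bigcup_n F n) = \bigcup_n trace p (F n).
Proof.
apply/seteqP; split=> [t [tp [n _ Fn]]|t [n _ [tp Fn]]]; first by exists n.
by split=> //; exists n.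
Qed.

(** Sets contained in one segment are enough to determine the length measure,
    and easy to measure: all the traces of such a set are pieces of a single
    one.  Being closed under differences, they form a semiring, to which the
    extension theorem for measures applies, whatever the number of branches of
    the tree. *)
Definition small_sets : set (set T) :=
  [set A | (exists p, A `<=` root_segment r p) /\
           forall p, measurable (trace p A)].

Lemma small_set0 : small_sets set0.
Proof. by split; [exists r|move=> p; rewrite trace0]. Qed.

Lemma small_setI : setI_closed small_sets.
Proof.
move=> A B [[p Ap] mA] [_ mB]; split.
  by exists p => z [/Ap].
by move=> q; rewrite traceI; exact: measurableI.
Qed.

Lemma small_setD : semi_setD_closed small_sets.
Proof.
apply: setD_semi_setD_closed => A B [[p Ap] mA] [_ mB]; split.
  by exists p => z [/Ap].
by move=> q; rewrite traceD; exact: measurableD.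
Qed.

Definition rooted : Type := T.

HB.instance Definition _ := Choice.on rooted.
HB.instance Definition _ := isPointed.Build rooted r.
HB.instance Definition _ := isSemiRingOfSets.Build default_measure_display
  rooted small_set0 small_setI small_setD.

(** The supremum is attained on any segment that contains [A]
    ([trace_lengthE]). *)
Definition trace_length (A : set rooted) : \bar R :=
  ereal_sup [set lebesgue_measure (trace p A) | p in [set: T]].

Hypothesis T4 : four_point_condition T.
Hypothesis T_geo : geodesic_space (T := T).

Lemma trace_lengthE p A : small_sets A -> A `<=` root_segment r p ->
  trace_length A = lebesgue_measure (trace p A).
Proof.
move=> [_ mA] Ap; apply/eqP; rewrite eq_le; apply/andP; split; last first.
  by apply: ereal_sup_ubound; exists p.
apply: ge_ereal_sup => _ [q _ <-]; apply: le_measure; rewrite ?inE//.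
move=> t [tq At]; have [tp tE] := point_at_segment T4 T_geo tq (Ap _ At).
by split; [rewrite tp andbT; case/andP: tq|rewrite tE].
Qed.

Lemma trace_length0 : trace_length set0 = 0.
Proof. by rewrite (trace_lengthE (p := r) small_set0)// trace0 measure0. Qed.

Lemma trace_length_ge0 A : (0 <= trace_length A)%E.
Proof.
apply: (@le_trans _ _ (lebesgue_measure (trace r A))); first exact: measure_ge0.
by apply: ereal_sup_ubound; exists r.
Qed.

(** All the sets involved lie in one segment, so that additivity is that of
    Lebesgue measure. *)
Lemma trace_length_sigma_additive : semi_sigma_additive trace_length.
Proof.
move=> F mF tF mUF; have [[p Up] mU] := mUF.
have Fp n : F n `<=` root_segment r p.
  by apply: subset_trans Up; exact: bigcup_sup.
rewrite (trace_lengthE (p := p))// trace_bigcup.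
have -> : (fun n => \sum_(0 <= i < n) trace_length (F i))%E =
    (fun n => \sum_(0 <= i < n) lebesgue_measure (trace p (F i)))%E.
  apply/funext => n; apply: eq_bigr => i _.
  exact: trace_lengthE (mF i) (Fp i).
apply: measure_semi_sigma_additive.
- by move=> n; have [] := mF n.
- move=> i j _ _ [t [[_ Fi] [_ Fj]]]; apply: (tF i j) => //.
  by exists (point_at r p t).
- by rewrite -trace_bigcup; exact: mU.
Qed.

Definition segment_length : {measure set rooted -> \bar R} :=
  HB.pack trace_length (isMeasure.Build _ _ _ trace_length
    trace_length0 trace_length_ge0 trace_length_sigma_additive).

Lemma trace_root_segment p q :
  trace q (root_segment r p) = `[0, gromov r p q]%classic.
Proof.
apply/seteqP; split=> t /=; rewrite in_itv/=.
  move=> [tq tp]; have [tq' tE] := point_atP T_geo tq.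
  have /andP[-> _] := tq; rewrite /= -tE.
  apply: le_trans (gromov_ultra T4 r (point_at r q t) p q).
  by rewrite le_min gromovC !(root_segmentP r _ _).1.
move=> /andP[t0 tpq].
have tq : 0 <= t <= mdist r q by rewrite t0 (le_trans tpq)// gromovC gromov_le.
split=> //; have [tq' tE] := point_atP T_geo tq.
apply/root_segmentP; apply: le_trans (gromov_ultra T4 r q _ p).
by rewrite le_min (root_segmentP r _ _).1// tE gromovC.
Qed.

Lemma small_root_segment p : small_sets (root_segment r p).
Proof.
by split=> [|q]; [exists p|rewrite trace_root_segment; exact: measurable_itv].
Qed.

(** The measure space is the tree itself, but its sigma-algebra depends on the
    root and is not a structure that the type [T] carries: [f] is the identity
    map between the two. *)
Theorem exists_length_measure : exists d (X : measurableType d)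
  (mu : {measure set X -> \bar R}) (f : X -> T), forall p,
  measurable (f @^-1` root_segment r p) /\
  mu (f @^-1` root_segment r p) = (mdist r p)%:E.
Proof.
exists _, (g_sigma_algebraType (@measurable _ rooted)).
exists (measure_extension segment_length), idfun => p.
have Sp : (measurable : set (set rooted)) (root_segment r p).
  exact: small_root_segment.
split; first exact: sub_sigma_algebra.
rewrite /= /measure_extension measurable_mu_extE//=.
rewrite (trace_lengthE (small_root_segment p) (@subset_refl _ _)).
rewrite trace_root_segment gromovxx lebesgue_measure_itv/= lte_fin.
by case: ltgtP (mdist_ge0 r p) => // [_|<-]; rewrite ?sube0.
Qed.

End small_sets.

(** * Combinations of indicators of segments *)

Section summable_functions.
Context {R : realType} d (X : measurableType d).
Variable mu : {measure set X -> \bar R}.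
Implicit Types (f g h : X -> R) (a : R).

Definition summable_fun f := mu.-integrable [set: X] (EFin \o f).
Definition L1norm f : R := \int[mu]_x `|f x|.

Lemma summable_fun_measurable f : summable_fun f -> measurable_fun setT f.
Proof. by move=> /measurable_int/measurable_EFinP. Qed.

Lemma summable_funD f g : summable_fun f -> summable_fun g ->
  summable_fun (fun x => f x + g x).
Proof. by move=> sf sg; exact: (integrableD measurableT sf sg). Qed.

Lemma summable_funZ a f : summable_fun f -> summable_fun (fun x => a * f x).
Proof. by move=> sf; exact: (integrableZl measurableT a sf). Qed.

Lemma summable_funB f g : summable_fun f -> summable_fun g ->
  summable_fun (fun x => f x - g x).
Proof. by move=> sf sg; exact: (integrableB measurableT sf sg). Qed.

Lemma summable_fun_norm f : summable_fun f -> summable_fun (fun x => `|f x|).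
Proof. exact: integrable_norm. Qed.

Lemma summable_fun_sum (I : finType) (A : {pred I}) (f : I -> X -> R) :
  (forall i, summable_fun (f i)) ->
  summable_fun (fun x => \sum_(i in A) f i x).
Proof.
move=> sf; rewrite /summable_fun.
have -> : EFin \o (fun x => \sum_(i in A) f i x) =
    (fun x => \sum_(i in A) (f i x)%:E)%E.
  by apply/funext => x /=; rewrite sumEFin.
by apply: integrable_sum => // i _; exact: sf.
Qed.

Lemma summable_fun_dominated f g : measurable_fun setT f ->
  (forall x, `|f x| <= `|g x|) -> summable_fun g -> summable_fun f.
Proof.
move=> mf fg; apply: le_integrable => //; first exact/measurable_EFinP.
by move=> x _; rewrite /= lee_fin.
Qed.

Lemma L1normE f : summable_fun f ->
  (L1norm f)%:E = (\int[mu]_x (`|f x|)%:E)%E.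
Proof.
move=> /summable_fun_norm sf; rewrite /L1norm /Rintegral fineK//.
exact: integrable_fin_num.
Qed.

Lemma L1norm_ge0 f : 0 <= L1norm f.
Proof. exact: Rintegral_ge0. Qed.

Lemma le_L1norm f g : summable_fun f -> summable_fun g ->
  (forall x, `|f x| <= `|g x|) -> L1norm f <= L1norm g.
Proof.
move=> sf sg fg; apply: le_Rintegral => //; exact: summable_fun_norm.
Qed.

Lemma ler_L1normD f g : summable_fun f -> summable_fun g ->
  L1norm (fun x => f x + g x) <= L1norm f + L1norm g.
Proof.
move=> sf sg; rewrite /L1norm -RintegralD//; [|exact: summable_fun_norm..].
apply: le_Rintegral => //; first by apply/summable_fun_norm/summable_funD.
  by apply: summable_funD; exact: summable_fun_norm.
by move=> x _; exact: ler_normD.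
Qed.

Lemma L1normZ a f : summable_fun f ->
  L1norm (fun x => a * f x) = `|a| * L1norm f.
Proof.
move=> sf; rewrite /L1norm -RintegralZl//; last exact: summable_fun_norm.
by apply: eq_Rintegral => x _; rewrite normrM.
Qed.

End summable_functions.

Section merge.
Context {R : realType} {I : finType}.
Implicit Types (A : {set I}) (i j : I).

Lemma big_merge {T : Type} (F : T -> R) A (a : I -> R) (p : I -> T) q i j :
  i \in A -> j \in A -> i != j ->
  \sum_(k in A :\ i) (if k == j then a i + a j else a k) *
                      F (if k == j then q else p k)
  = (a i + a j) * F q + \sum_(k in (A :\ i) :\ j) a k * F (p k).
Proof.
move=> iA jA ij; rewrite (big_setD1 j)/=; last by rewrite !inE eq_sym ij.
rewrite eqxx; congr (_ + _); apply: eq_bigr => k; rewrite !inE.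
by case/andP=> /negPf ->.
Qed.

Lemma big_split2 {T : Type} (F : T -> R) A (a : I -> R) (p : I -> T) i j :
  i \in A -> j \in A -> i != j ->
  \sum_(k in A) a k * F (p k) =
  a i * F (p i) + (a j * F (p j) + \sum_(k in (A :\ i) :\ j) a k * F (p k)).
Proof.
move=> iA jA ij; rewrite (big_setD1 i)//= (big_setD1 j)//=.
by rewrite !inE eq_sym ij.
Qed.

End merge.

Section length_norm.
Context {R : realType} {T : metricType R} (r : T).
Hypothesis T4 : four_point_condition T.
Hypothesis T_geo : geodesic_space (T := T).
Context d (X : measurableType d).
Variables (mu : {measure set X -> \bar R}) (f : X -> T).
Hypothesis f_len : forall p, measurable (f @^-1` root_segment r p) /\
  mu (f @^-1` root_segment r p) = (mdist r p)%:E.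

Local Notation S := (root_segment r).

Definition ind p : X -> R := \1_(f @^-1` S p).

Local Notation sfun := (summable_fun mu).

Lemma ind_ge0 p x : 0 <= ind p x.
Proof. by rewrite /ind indicE. Qed.

Lemma summable_ind p : sfun (ind p).
Proof.
have [mS lenS] := f_len p; apply/integrableP; split.
  exact/measurable_EFinP/measurable_indic.
rewrite (eq_integral (fun x => (ind p x)%:E)) => [|x _]; last first.
  by rewrite /= ger0_norm// ind_ge0.
by rewrite integral_indic// setIT [ltLHS]lenS ltry.
Qed.

Lemma integral_ind p : \int[mu]_x ind p x = mdist r p.
Proof.
have [mS lenS] := f_len p.
by rewrite /Rintegral integral_indic// setIT [X in fine X]lenS.
Qed.

Lemma ind_meet p q m : mdist r m = gromov r p q -> S p m -> S q m ->
  forall x, ind m x = ind p x * ind q x.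
Proof.
move=> mE mp mq x; rewrite /ind -[RHS]/((\1_ _ \* \1_ _) x) -indicI.
by rewrite -preimage_setI (root_segmentI T4 mE).
Qed.

Lemma L1norm_indB p q : L1norm mu (fun x => ind p x - ind q x) = mdist p q.
Proof.
have [m [mE mp mq]] := exists_meet r T4 T_geo p q.
rewrite /L1norm.
under eq_Rintegral => x _.
  have -> : `|ind p x - ind q x| = ind p x + ind q x - 2 * ind m x.
    rewrite (ind_meet mE mp mq) /ind !indicE.
    by do 2 case: (_ \in _); rewrite ?(mulr0, mul0r, subr0, sub0r, subrr,
      normrN, normr1, normr0, add0r, addr0, mulr1)//; lra.
  over.
have sp := summable_ind p; have sq := summable_ind q.
have sm := summable_funZ 2 (summable_ind m).
rewrite RintegralB//; last exact: summable_funD.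
rewrite RintegralD// RintegralZl//; last exact: summable_ind.
by rewrite !integral_ind mE /gromov; lra.
Qed.

Definition combination {I : finType} (A : {set I}) (a : I -> R) (p : I -> T)
  (x : X) : R := \sum_(k in A) a k * ind (p k) x.

Lemma summable_combination (I : finType) (A : {set I}) (a : I -> R) p :
  sfun (combination A a p).
Proof.
by apply: summable_fun_sum => k; apply: summable_funZ; exact: summable_ind.
Qed.

(** Merging two points into their branching point [q].  As the segments to
    [p i] and [p j] separate last, what they contain above [q] is disjoint from
    all the other segments, and contributes separately to the norm. *)
Lemma merge_norm (I : finType) (A : {set I}) (a : I -> R) (p : I -> T)
    (i j : I) (q : T) :
  i \in A -> j \in A -> i != j ->
  mdist r q = gromov r (p i) (p j) -> S (p i) q -> S (p j) q ->
  {in A &, forall k l, k != l ->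
     gromov r (p k) (p l) <= gromov r (p i) (p j)} ->
  L1norm mu (combination A a p) =
  `|a i| * mdist q (p i) + `|a j| * mdist q (p j) +
  L1norm mu (combination (A :\ i) (fun k => if k == j then a i + a j else a k)
                         (fun k => if k == j then q else p k)).
Proof.
move=> iA jA ij qE qi qj ij_max.
set b := fun k => _; set p' := fun k => _.
(* two of the segments, one of them being that of [i] or [j], meet below [q] *)
have rest0 k l z : k \in A -> l \in A -> k != l ->
    (k == i) || (k == j) -> S (p k) z -> S (p l) z -> S q z.
  move=> kA lA kl kij zk zl.
  have [m [mE mk ml]] := exists_meet r T4 T_geo (p k) (p l).
  have kq : S (p k) q by case/orP: kij => /eqP ->.
  have zm : S m z by rewrite -(root_segmentI T4 mE).
  have /root_segmentP mk' := mk; have /root_segmentP kq' := kq.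
  suff qm : S q m by exact: root_segment_subset qm _ zm.
  apply/root_segmentP; apply: le_trans (gromov_ultra T4 r (p k) m q).
  rewrite le_min mk' gromovC (le_trans _ kq')// mE qE.
  exact: ij_max.
have normE x : `|combination A a p x| =
    `|a i| * (ind (p i) x - ind q x) + `|a j| * (ind (p j) x - ind q x) +
    `|combination (A :\ i) b p' x|.
  rewrite /combination (big_split2 (fun p => ind p x) a p iA jA ij)//.
  rewrite (big_merge (fun p => ind p x) a p q iA jA ij)//.
  set rest := \sum_(k in _) _.
  have ind_q := ind_meet qE qi qj x.
  have [/set_mem/= xq|xq] := boolP (x \in f @^-1` S q).
    have [-> ->] : ind (p i) x = 1 /\ ind (p j) x = 1.
      rewrite /ind !indicE !mem_set//=; exact: root_segment_subset xq.
    have -> : ind q x = 1 by rewrite /ind indicE mem_set.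
    by rewrite subrr !mulr0 !mulr1 !add0r addrA.
  have q0 : ind q x = 0 by rewrite /ind indicE (negPf xq).
  have out k l : k \in A -> l \in A -> k != l -> (k == i) || (k == j) ->
      ind (p k) x = 1 -> ind (p l) x = 0.
    move=> kA lA kl kij; rewrite /ind !indicE.
    have [/set_mem/= xk _|_ /eqP] := boolP (x \in _); last first.
      by rewrite eq_sym oner_eq0.
    have [/set_mem/= xl|//] := boolP (x \in f @^-1` S (p l)).
    case/negP: xq; apply/mem_set => /=.
    exact: rest0 kA lA kl kij xk xl.
  have rest_0 k : (k == i) || (k == j) -> k \in A -> ind (p k) x = 1 ->
      rest = 0.
    move=> kij kA xk; apply: big1 => l; rewrite !inE => /and3P[lj li lA].
    rewrite (out k l)// ?mulr0//; apply: contraTneq kij => ->.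
    by rewrite negb_or li.
  rewrite q0 mulr0 add0r !subr0.
  have [i0|i1] : ind (p i) x = 0 \/ ind (p i) x = 1.
    by rewrite /ind indicE; case: (_ \in _); [right|left].
    rewrite i0 !mulr0 !add0r.
    have [j0|j1] : ind (p j) x = 0 \/ ind (p j) x = 1.
      by rewrite /ind indicE; case: (_ \in _); [right|left].
      by rewrite j0 !mulr0 !add0r.
    by rewrite (rest_0 j)// ?eqxx ?orbT// j1 !mulr1 addr0 normr0 addr0.
  rewrite (rest_0 i)// ?eqxx// (out i j)// ?eqxx//.
  by rewrite i1 !mulr1 !mulr0 !addr0 normr0 addr0.
have sB k : sfun (fun x => ind (p k) x - ind q x).
  by apply: summable_funB; exact: summable_ind.
rewrite {1}/L1norm; under eq_Rintegral do rewrite normE.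
have sc := summable_combination (A :\ i) b p'.
rewrite RintegralD//; [|by apply: summable_funD; exact: summable_funZ
  |exact: summable_fun_norm].
rewrite RintegralD//; [|exact: summable_funZ..].
rewrite RintegralZl//; last exact: sB.
rewrite RintegralZl//; last exact: sB.
rewrite !RintegralB//; [|exact: summable_ind..].
rewrite !integral_ind; congr (_ * _ + _ * _ + _).
  by have := qi; rewrite /root_segment /between/=; lra.
by have := qj; rewrite /root_segment /between/=; lra.
Qed.

(** By induction on the number of points, merging the two points with the
    largest Gromov product. *)
Lemma lipschitz_combination_le (h : T -> R) (L : R) (I : finType)
    (A : {set I}) (a : I -> R) (p : I -> T) :
  0 <= L -> h r = 0 -> (forall u v, `|h u - h v| <= L * mdist u v) ->
  `|\sum_(k in A) a k * h (p k)| <= L * L1norm mu (combination A a p).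
Proof.
move=> L0 hr hL; have [n] := ubnP #|A|; elim: n A a p => // n IHn A a p An.
have [A1|/card_gt1P[i0 [j0 [i0A j0A ij0]]]] := leqP #|A| 1.
  move: A1; rewrite leq_eqVlt ltnS leqn0 => /orP[/cards1P[i ->]|]; last first.
    rewrite cards_eq0 => /eqP ->; rewrite big_set0 normr0 mulr_ge0//.
    exact: L1norm_ge0.
  have -> : combination [set i] a p = fun x => a i * ind (p i) x.
    by apply/funext => x; rewrite /combination big_set1.
  rewrite big_set1 L1normZ; last exact: summable_ind.
  rewrite normrM mulrCA ler_wpM2l//.
  have -> : L1norm mu (ind (p i)) = mdist (p i) r.
    rewrite metric_sym -integral_ind; apply: eq_Rintegral => x _.
    by rewrite ger0_norm// ind_ge0.
  by have := hL (p i) r; rewrite hr subr0.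
pose P (c : I * I) := [&& c.1 \in A, c.2 \in A & c.1 != c.2].
pose G (c : I * I) := gromov r (p c.1) (p c.2).
have P0 : P (i0, j0) by apply/and3P.
case: (arg_maxP G P0) => -[i j] /and3P[/= iA jA ij] ij_max.
have [q [qE qi qj]] := exists_meet r T4 T_geo (p i) (p j).
rewrite (merge_norm a iA jA ij qE qi qj) => [|k l kA lA kl]; last first.
  by apply: (ij_max (k, l)); apply/and3P.
pose b k := if k == j then a i + a j else a k.
pose p' k := if k == j then q else p k.
have Ai : (#|A :\ i| < n)%N by move: An; rewrite (cardsD1 i A) iA.
have := IHn (A :\ i) b p' Ai.
rewrite (big_merge h a p q iA jA ij) (big_split2 h a p iA jA ij) !mulrDr.
set s := \sum_(k in _) _ => le_merged.
have -> : a i * h (p i) + (a j * h (p j) + s) =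
    a i * (h (p i) - h q) + a j * (h (p j) - h q) + ((a i + a j) * h q + s).
  by ring.
apply: (le_trans (ler_normD _ _)); apply: lerD => //.
apply: (le_trans (ler_normD _ _)); rewrite !normrM.
by apply: lerD; rewrite mulrCA ler_wpM2l// (metric_sym q).
Qed.

(** The derivative of the extremal function along the segments is the sign of
    the combination. *)
Lemma combination_attained (I : finType) (A : {set I}) (a : I -> R)
    (p : I -> T) :
  exists h : T -> R, [/\ h r = 0, forall u v, `|h u - h v| <= mdist u v &
    \sum_(k in A) a k * h (p k) = L1norm mu (combination A a p)].
Proof.
set g := combination A a p.
have sg : sfun g by exact: summable_combination.
pose sigma x : R := if 0 <= g x then 1 else -1.
have m_sigma : measurable_fun setT sigma.
  apply: measurable_fun_ifT => //.
  by apply: measurable_fun_ler => //; exact: summable_fun_measurable sg.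
have norm_sigma x : `|sigma x| = 1.
  by rewrite /sigma; case: ifP; rewrite ?normrN normr1.
have s_sigma k : sfun k -> sfun (fun x => k x * sigma x).
  move=> sk; apply: (summable_fun_dominated _ _ sk).
    by apply: measurable_funM => //; exact: summable_fun_measurable sk.
  by move=> x; rewrite normrM norm_sigma mulr1.
pose h u : R := \int[mu]_x (ind u x * sigma x).
have h_le k : sfun k -> `|\int[mu]_x (k x * sigma x)| <= L1norm mu k.
  move=> sk; apply: le_trans (le_normr_Rintegral _ (s_sigma _ sk)) _ => //.
  rewrite /L1norm; under eq_Rintegral do rewrite normrM norm_sigma mulr1.
  exact: lexx.
exists h; split.
- apply/eqP; rewrite -normr_le0; apply: le_trans (h_le _ (summable_ind r)) _.
  rewrite /L1norm; under eq_Rintegral do rewrite ger0_norm ?ind_ge0//.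
  by rewrite integral_ind mdistxx.
- move=> u v; rewrite -L1norm_indB /h.
  rewrite -RintegralB//; [|exact/s_sigma/summable_ind..].
  under eq_Rintegral do rewrite -mulrBl.
  by apply: h_le; apply: summable_funB; exact: summable_ind.
- rewrite /L1norm.
  under [RHS]eq_Rintegral => x _.
    have -> : `|g x| = \sum_(k in A) a k * (ind (p k) x * sigma x).
      have -> : `|g x| = g x * sigma x.
        rewrite /sigma; case: ifPn => gx; first by rewrite mulr1 ger0_norm.
        by rewrite mulrN1 ltr0_norm// ltNge.
      rewrite /g /combination mulr_suml.
      by apply: eq_bigr => k _; rewrite mulrA.
    over.
  rewrite [RHS]/Rintegral.
  under eq_integral do rewrite -sumEFin.
  have si k : mu.-integrable setT (fun x => (a k * (ind (p k) x * sigma x))%:E).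
    by apply: (summable_funZ (mu := mu)); apply: s_sigma; exact: summable_ind.
  rewrite (integral_sum measurableT)// -sum_fine//; last first.
    by move=> k _; exact: integrable_fin_num.
  apply: eq_bigr => k _; rewrite -/(Rintegral _ _ _) RintegralZl//.
  exact/s_sigma/summable_ind.
Qed.

End length_norm.

(** * Extending an isometry from a dense part into L1 *)

Section L1_completeness.
Context {R : realType} d (X : measurableType d).
Variable mu : {measure set X -> \bar R}.

Let half_pow (k : nat) : R := 1 / (2 ^ (k + 1))%:R.

(** As in the proof of the Riesz-Fischer theorem: the sum [H] of the increments
    is summable, hence finite almost everywhere, so that the sequence converges
    almost everywhere and is dominated by [`|f_ 0| + H]. *)
Lemma L1_complete (f_ : nat -> X -> R) :
  (forall n, summable_fun mu (f_ n)) ->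
  (forall n, L1norm mu (fun x => f_ n.+1 x - f_ n x) <= half_pow n) ->
  exists2 f, summable_fun mu f &
    (fun n => L1norm mu (fun x => f_ n x - f x)) @ \oo --> 0.
Proof.
move=> sf f_le.
pose D k x := `|f_ k.+1 x - f_ k x|.
have D0 k x : 0 <= D k x by exact: normr_ge0.
have sB k : summable_fun mu (fun x => f_ k.+1 x - f_ k x).
  exact: (summable_funB (sf k.+1) (sf k)).
have sD k : summable_fun mu (D k) by exact: (summable_fun_norm (sB k)).
have mD k : measurable_fun setT (fun x => (D k x)%:E).
  exact: measurable_int (sD k).
pose H x := (\sum_(k <oo) (D k x)%:E)%E.
have H0 x : (0 <= H x)%E by apply: nneseries_ge0 => n _ _; rewrite lee_fin.
have mH : measurable_fun setT H.
  by apply: ge0_emeasurable_sum => // k x _; rewrite lee_fin.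
have iH : mu.-integrable setT H.
  apply/integrableP; split => //.
  rewrite (eq_integral H) => [|x _]; last by rewrite gee0_abs.
  rewrite integral_nneseries//; last by move=> k x _; rewrite lee_fin.
  apply: (@le_lt_trans _ _ (\sum_(k <oo) (half_pow k)%:E)%E).
    apply: lee_nneseries => [k _ _|k _].
      by apply: integral_ge0 => x _; rewrite lee_fin.
    rewrite -[leLHS](L1normE (sB k)) lee_fin; exact: f_le.
  have /cvg_lim := @cvg_geometric_eseries_half R 1 0.
  by rewrite /half_pow => -> //; rewrite ltry.
pose E := [set x | (H x < +oo)%E].
have mE : measurable E.
  by rewrite -[E]setTI; exact: emeasurable_fun_infty_o.
have f_sum n x : f_ n x = f_ 0%N x + series (fun k => f_ k.+1 x - f_ k x) n.
  by rewrite /series/= telescope_sumr// addrC subrK.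
have f_cvg x : E x -> cvgn (fun n => f_ n x).
  rewrite /E /= => Hx.
  have -> : (fun n => f_ n x) =
      (fun n => f_ 0%N x + series (fun k => f_ k.+1 x - f_ k x) n).
    by apply/funext => n; exact: f_sum.
  apply: is_cvgD; first exact: is_cvg_cst.
  apply: normed_cvg; apply: nondecreasing_is_cvgn.
    apply/nondecreasing_seqP => n; rewrite /= /series/= big_nat_recr//= lerDl.
    exact: normr_ge0.
  exists (fine (H x)) => _ [n _ <-].
  rewrite -lee_fin fineK; last by rewrite ge0_fin_numE.
  rewrite /= /series/= -sumEFin.
  by apply: nneseries_lim_ge => k _ _; rewrite lee_fin.
(* cutting off outside of [E] makes the limit exist everywhere *)
pose f x := lim ((fun n => \1_E x * f_ n x) @ \oo).
have f_f x : (fun n => \1_E x * f_ n x) @ \oo --> f x.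
  apply/cvg_ex; rewrite indicE; have [/set_mem xE|xE] := boolP (x \in E).
    exists (lim ((fun n => f_ n x) @ \oo)).
    by under eq_fun do rewrite mul1r; exact: f_cvg.
  by exists 0; under eq_fun do rewrite mul0r; exact: cvg_cst.
have mf : measurable_fun setT f.
  apply: (measurable_fun_cvg (h := fun n x => \1_E x * f_ n x)) => //.
  move=> n; apply: measurable_funM; first exact: measurable_indic.
  exact: summable_fun_measurable (sf n).
pose g x := ((`|f_ 0%N x|%R)%:E + H x)%E.
have ig : mu.-integrable setT g.
  exact: (integrableD measurableT (summable_fun_norm (sf 0%N)) iH).
have [] := @dominated_convergence _ _ _ mu setT measurableT
  (fun n => EFin \o f_ n) (EFin \o f) g.
- by move=> n; exact: measurable_int (sf n).
- exact/measurable_EFinP.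
- have := integrable_ae measurableT iH; apply: filterS => x /(_ I) Hx _.
  have xE : x \in E by apply/mem_set; rewrite /E /= -ge0_fin_numE.
  apply: cvg_EFin; first exact: nearW.
  have := f_f x; rewrite indicE xE; under eq_fun do rewrite mul1r; exact.
- exact: ig.
- apply: aeW => x n _; rewrite /g /= f_sum.
  apply: (@le_trans _ _ ((`|f_ 0%N x|%R)%:E +
      (`|series (fun k => f_ k.+1 x - f_ k x)%R n|%R)%:E)%E).
    by rewrite -EFinD lee_fin ler_normD.
  rewrite leeD2l//.
  apply: (@le_trans _ _ (\sum_(0 <= k < n) (D k x)%:E)%E).
    by rewrite sumEFin lee_fin ler_norm_sum.
  by apply: nneseries_lim_ge => k _ _; rewrite lee_fin.
move=> i_f f_to0 _; exists f => //.
exact: (fine_cvg f_to0).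
Qed.

End L1_completeness.

Section L1_classes.
Context {R : realType} d (X : measurableType d).
Variable mu : {measure set X -> \bar R}.

Lemma eq_L1_Lnorm (f g : X -> R) : measurable_fun setT f ->
  measurable_fun setT g -> f = g %[ae mu] ->
  ('N[mu]_1[EFin \o f] = 'N[mu]_1[EFin \o g])%E.
Proof.
move=> mf mg fg; rewrite !Lnorm1; apply: ge0_ae_eq_integral => //.
- by apply: measurableT_comp => //; exact/measurable_EFinP.
- by apply: measurableT_comp => //; exact/measurable_EFinP.
- by apply: filterS fg => x /(_ I) fg _; rewrite /= fg.
Qed.

Lemma LspaceType1_measurable (J : LspaceType1 mu) : measurable_fun setT J.
Proof. exact: measurable_funPT. Qed.

Lemma Lnorm_summable f : summable_fun mu f ->
  ('N[mu]_1[EFin \o f] = (L1norm mu f)%:E)%E.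
Proof. by move=> sf; rewrite L1normE// Lnorm1. Qed.

Lemma exists_L1_class f : summable_fun mu f ->
  exists J : LspaceType1 mu, J = f %[ae mu].
Proof.
move=> sf; have mf := summable_fun_measurable sf.
pose m : {mfun X >-> measurableTypeR R} :=
  HB.pack f (isMeasurableFun.Build _ _ _ (measurableTypeR R) f mf).
pose c : {mfun_ mu, X >-> measurableTypeR R} := (\pi m)%qT.
have cf : (c : X -> R) = f %[ae mu].
  have : (repr c == m %[mod {mfun_ mu, X >-> measurableTypeR R}])%qT.
    by rewrite reprK.
  by rewrite eqmodE => /asboolP.
have mc : measurable_fun setT (c : X -> R).
  exact: (measurable_funPT (repr c)).
have c_fin : finite_norm mu 1 (c : X -> R).
  by rewrite /finite_norm (eq_L1_Lnorm mc mf cf) Lnorm_summable// ltry.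
pose J : LspaceType1 mu :=
  HB.pack c (isFinLebesgue.Build _ _ _ mu 1%E (lexx 1%E) c c_fin).
by exists J.
Qed.

End L1_classes.

(** A linear isometric relation between a dense part of [V] and the summable
    functions extends to [V] because [L1] is complete.  Working with the graph
    of the isometry avoids any choice of representation for the elements of
    the dense part. *)
Section extension_by_density.
Context {R : realType} d (X : measurableType d).
Variable mu : {measure set X -> \bar R}.
Context {V : normedModType R} (G : V -> (X -> R) -> Prop).
Hypothesis G_lin : forall a u f v g, G u f -> G v g ->
  G (a *: u + v) (fun x => a * f x + g x).
Hypothesis G_summable : forall u f, G u f -> summable_fun mu f.
Hypothesis G_isometric : forall u f, G u f -> L1norm mu f = `|u|.
Hypothesis G_dense : forall (v : V) (e : R), 0 < e ->
  exists u f, G u f /\ `|v - u| < e.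

(** [(v, f)] belongs to the closure of the graph. *)
Definition represents (v : V) (f : X -> R) := summable_fun mu f /\
  forall e : R, 0 < e -> exists u g, [/\ G u g, `|v - u| < e &
    L1norm mu (fun x => g x - f x) < e].

Let G_sub u f v g : G u f -> G v g -> G (u - v) (fun x => f x - g x).
Proof.
move=> Gu Gv; have := G_lin (-1) Gv Gu; rewrite scaleN1r addrC.
by congr G; apply/funext => x; rewrite mulN1r addrC.
Qed.

Lemma exists_representation v : exists f, represents v f.
Proof.
pose e (n : nat) : R := 1 / (2 ^ (n + 1))%:R.
have e0 n : 0 < e n by rewrite divr_gt0// ltr0n expn_gt0.
have e_dec n : e n.+1 <= e n.
  rewrite /e ler_pM2l// lef_pV2 ?posrE ?ltr0n ?expn_gt0// ler_nat.
  by rewrite leq_exp2l// leq_add2r.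
have /(_ _)/cid2 uf n : exists2 uf : V * (X -> R), G uf.1 uf.2 &
    `|v - uf.1| < e n / 2.
  have [u [f [Gu vu]]] := @G_dense v (e n / 2) (divr_gt0 (e0 n) (ltr0n _ 2)).
  by exists (u, f).
pose u n := (sval (uf n)).1; pose f n := (sval (uf n)).2.
have Guf n : G (u n) (f n) by rewrite /u /f; case: (uf n).
have vu n : `|v - u n| < e n / 2 by rewrite /u; case: (uf n).
have sf n : summable_fun mu (f n) by exact: G_summable (Guf n).
have [n|g sg fg] := L1_complete sf.
  rewrite (G_isometric (G_sub (Guf n.+1) (Guf n))).
  have -> : u n.+1 - u n = (v - u n) - (v - u n.+1).
    by rewrite opprB [RHS]addrC subrKA.
  apply: (le_trans (ler_normB _ _)).
  by have := vu n; have := vu n.+1; have := e_dec n; rewrite -/(e n); lra.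
exists g; split=> // eps eps0.
have e_le n : e n <= n.+1%:R^-1.
  rewrite /e div1r lef_pV2 ?posrE ?ltr0n ?expn_gt0// ler_nat addn1.
  exact/ltnW/ltn_expl.
have /cvgrPdist_lt/(_ eps eps0) fg' := fg.
near \oo => n.
exists (u n), (f n); split=> //.
  apply: (lt_le_trans (vu n)); apply: (@le_trans _ _ (e n)).
    by have := e0 n; lra.
  apply: (le_trans (e_le n)); apply: ltW.
  by near: n; exact: near_infty_natSinv_lt (PosNum eps0).
have : `|0 - L1norm mu (fun x => f n x - g x)| < eps by near: n.
by rewrite sub0r normrN ger0_norm// L1norm_ge0.
Unshelve. all: by end_near. Qed.

Lemma represents_isometric v f : represents v f -> L1norm mu f = `|v|.
Proof.
move=> [sf vf]; apply/eqP; rewrite eq_le; apply/andP; split;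
  apply/ler_addgt0Pl => e e0;
  have [|u [g [Gu vu gf]]] := vf (e / 2); rewrite ?divr_gt0//;
  have sg := G_summable Gu; have gu := G_isometric Gu.
  have : L1norm mu f <= L1norm mu (fun x => -1 * (g x - f x) + g x).
    apply: le_L1norm => //.
      exact/summable_funD/sg/summable_funZ/summable_funB.
    by move=> x; rewrite mulN1r opprB subrK.
  have := ler_L1normD (summable_funZ (-1) (summable_funB sg sf)) sg.
  rewrite L1normZ; last exact: summable_funB.
  rewrite normrN1 mul1r gu; have := ler_normB v (v - u).
  rewrite opprB addrC subrK; lra.
have : L1norm mu g <= L1norm mu (fun x => (g x - f x) + f x).
  apply: le_L1norm => //; first exact/summable_funD/sf/summable_funB.
  by move=> x; rewrite subrK.
have := ler_L1normD (summable_funB sg sf) sf.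
rewrite gu; have := ler_normD (v - u) u.
rewrite subrK; lra.
Qed.

Lemma represents_linear a u v f g h : represents u f -> represents v g ->
  represents (a *: u + v) h -> L1norm mu (fun x => h x - (a * f x + g x)) = 0.
Proof.
move=> [sf uf] [sg vg] [sh wh]; apply/eqP; rewrite eq_le L1norm_ge0 andbT.
apply/ler_addgt0Pl => e e0; rewrite addr0.
have a0 : 0 < 2 * (`|a| + 2) by have := normr_ge0 a; lra.
set c := 2 * (`|a| + 2) in a0.
have ec0 : 0 < e / c by exact: divr_gt0.
have [u' [f' [Gu uu ff]]] := uf _ ec0; have [v' [g' [Gv vv gg]]] := vg _ ec0.
have [w' [h' [Gw ww hh]]] := wh _ ec0.
have sf' := G_summable Gu; have sg' := G_summable Gv; have sh' := G_summable Gw.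
(* the defect of the three approximations is measured in [V] *)
have defect : L1norm mu (fun x => h' x - (a * f' x + g' x)) <=
    (`|a| + 2) * (e / c).
  rewrite (G_isometric (G_sub Gw (G_lin a Gu Gv))).
  have -> : w' - (a *: u' + v') =
      a *: (u - u') + (v - v') - (a *: u + v - w').
    by rewrite scalerBr addrACA -opprD opprB [RHS]addrC subrKA.
  apply: (le_trans (ler_normB _ _)).
  apply: (le_trans (lerD (ler_normD _ _) (lexx _))).
  rewrite normrZ !mulrDl; have := normr_ge0 a => an0.
  have := ler_wpM2l an0 (ltW uu); lra.
pose k x := -1 * (h' x - h x) + (a * (f' x - f x) + ((g' x - g x) +
  (h' x - (a * f' x + g' x)))).
have s1 : summable_fun mu (fun x => h' x - (a * f' x + g' x)).
  apply: summable_funB => //; apply: summable_funD => //.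
  exact: summable_funZ.
have s2 := summable_funD (summable_funB sg' sg) s1.
have s3 := summable_funD (summable_funZ a (summable_funB sf' sf)) s2.
have s4 := summable_funZ (-1) (summable_funB sh' sh).
have -> : (fun x => h x - (a * f x + g x)) = k.
  by apply/funext => x; rewrite /k; ring.
have := ler_L1normD (summable_funZ a (summable_funB sf' sf)) s2.
have := ler_L1normD s4 s3.
have := ler_L1normD (summable_funB sg' sg) s1; rewrite -/k.
rewrite !L1normZ; [|exact: summable_funB..].
have := ler_wpM2l (normr_ge0 a) (ltW ff).
rewrite normrN1 mul1r.
have : e = 2 * (`|a| + 2) * (e / c) by rewrite -/c mulrC divfK// gt_eqF.
move: defect gg hh; move: (e / c) => t; lra.
Qed.

Theorem dense_isometry_extends : isometric_to_subspace_of_L1 V.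
Proof.
have /choice[phi phiP] := exists_representation.
have /choice[J JE] : forall v, exists J : LspaceType1 mu, J = phi v %[ae mu].
  by move=> v; apply: exists_L1_class; have [] := phiP v.
exists d, X, mu, J; split=> [a u v|u]; last first.
  have [su _] := phiP u.
  rewrite (eq_L1_Lnorm _ _ (JE u)); last exact: summable_fun_measurable su.
    by rewrite (Lnorm_summable su) (represents_isometric (phiP u)).
  exact: LspaceType1_measurable.
have lin := represents_linear (phiP u) (phiP v) (phiP (a *: u + v)).
have [[su _] [sv _]] := (phiP u, phiP v); have [sw _] := phiP (a *: u + v).
pose k x := phi (a *: u + v) x - (a * phi u x + phi v x).
have sk : summable_fun mu k.
  apply: summable_funB => //; apply: summable_funD => //.
  exact: summable_funZ.
have /(ae_eq_integral_abs mu measurableT (measurable_int _ sk)) lin_ae :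
    (\int[mu]_x `|(EFin \o k) x| = 0)%E.
  by rewrite -(L1normE sk) lin.
apply: filterS (filterI lin_ae
  (filterI (JE u) (filterI (JE v) (JE (a *: u + v))))).
move=> x [/(_ I)/= [/eqP + [/(_ I) -> [/(_ I) -> /(_ I) ->]]]] _.
by rewrite subr_eq0 => /eqP.
Qed.

End extension_by_density.

(** * The Lipschitz-free space *)

Section McShane.
Context {R : realType} {M T : metricType R} (j : M -> T) (o : M).
Hypothesis j_iso : isometric_embedding j.

Lemma McShane_extension (f : M -> R) (L : R) : 0 <= L ->
  (forall x y, `|f x - f y| <= L * mdist x y) ->
  exists h : T -> R, (forall u v, `|h u - h v| <= L * mdist u v) /\
    forall x, h (j x) = f x.
Proof.
move=> L0 fL.
pose E u := [set f x + L * mdist (j x) u | x in [set: M]].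
have E_inf u : has_inf (E u).
  split; first by exists (f o + L * mdist (j o) u), o.
  exists (f o - L * mdist (j o) u) => _ [x _ <-].
  have := fL o x; rewrite ler_norml -(j_iso o x).
  have := ler_wpM2l L0 (metric_triangle (j o) u (j x)).
  by rewrite (metric_sym u); lra.
have h_le u v : inf (E u) <= inf (E v) + L * mdist u v.
  rewrite -lerBlDr; apply: lb_le_inf; first by case: (E_inf v).
  move=> _ [x _ <-]; rewrite lerBlDr.
  apply: (@le_trans _ _ (f x + L * mdist (j x) u)).
    by apply: ge_inf; [case: (E_inf u)|exists x].
  rewrite -addrA lerD2l -mulrDr ler_wpM2l// (metric_sym u).
  exact: metric_triangle.
exists (fun u => inf (E u)); split=> [u v|x].
  by rewrite ler_norml; have := h_le u v; have := h_le v u;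
    rewrite (metric_sym v u); lra.
apply/eqP; rewrite eq_le; apply/andP; split.
  apply: ge_inf; first by case: (E_inf (j x)).
  by exists x => //; rewrite mdistxx mulr0 addr0.
apply: lb_le_inf; first by case: (E_inf (j x)).
move=> _ [y _ <-]; have := fL x y; rewrite j_iso (metric_sym y x) ler_norml.
lra.
Qed.

End McShane.

Section Lip0_functions.
Context {R : realType} {M : metricType R} (o : M).
Implicit Types f : Lip0 o.

Lemma Lip0_origin f : f o = 0.
Proof. by have /set_mem[] := valP f. Qed.

Lemma Lip0_lipschitz f x y : `|f x - f y| <= `|f| * mdist x y.
Proof.
have /set_mem[_ f0] := valP f.
have : lipschitz_constants f `|f|.
  rewrite lipschitz_constantsE /Num.norm/= /lip_norm lipschitz_constantsE.
  apply: bounds_inf => [p|]; first exact: mdist_ge0.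
  by rewrite -lipschitz_constantsE.
by move=> [_ /(_ y x)]; rewrite (metric_sym y).
Qed.

Lemma exists_Lip0 (h : M -> R) : (forall x y, `|h x - h y| <= mdist x y) ->
  exists f : Lip0 o, (forall x, f x = h x - h o) /\ `|f| <= 1.
Proof.
move=> hL; have h1 : lipschitz_constants (fun x => h x - h o) 1.
  split=> // x y; rewrite mul1r opprB addrA subrK (metric_sym x y).
  exact: hL.
have h_mem : (fun x => h x - h o) \in Lip0_pred o.
  by apply/mem_set; split; [exact: subrr|exists 1].
exists (MkLip0 h_mem); split=> //.
by apply: ge_inf h1; exists 0 => K [].
Qed.

End Lip0_functions.

Section dual_norm.
Context {R : realType} {V : normedModType R}.
Implicit Types phi : dual V.

Lemma dual_norm_le phi K : 0 <= K -> (forall v, `|phi v| <= K * `|v|) ->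
  `|phi| <= K.
Proof. by move=> K0 phiK; apply: inf_bounds_le. Qed.

Lemma ler_dual_norm phi v : `|phi v| <= `|phi| * `|v|.
Proof.
have [phi_bounded|unbounded] := pselect (bounds (fun v : V => `|v|) phi !=set0).
  by have [_] := bounds_inf (fun v => normr_ge0 v) phi_bounded; exact.
(* otherwise the norm is the infimum of the empty set, which is [0] *)
have phi0 : phi = 0.
  apply: normr0_eq0; rewrite /Num.norm/= /dual_norm.
  have -> : bounds (fun v : V => `|v|) phi = set0.
    by apply/seteqP; split=> // K phiK; apply: unbounded; exists K.
  exact: inf0.
have -> : phi v = 0 by rewrite phi0.
by rewrite normr0 mulr_ge0.
Qed.

End dual_norm.

Section free_space.
Context {R : realType} {M : metricType R} (o : M).
Local Notation free := (lipschitz_free o).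

Let delta_mem x : evaluation o x \in closed_span (range (evaluation o)).
Proof.
apply/mem_set/subset_closure; exists 1%N, (fun=> 1), (fun=> evaluation o x).
by split; [exists x|rewrite big_ord1 scale1r].
Qed.

Definition delta x : free := MkLipschitzFree (delta_mem x).

Lemma free_combinationE (I : finType) (a : I -> R) (x : I -> M) (f : Lip0 o) :
  val (\sum_i a i *: delta (x i)) f = \sum_i a i * f (x i).
Proof.
rewrite raddf_sum /=.
rewrite -[LHS]/(val (\sum_i val (a i *: delta (x i))) f) raddf_sum fct_sumE.
by apply: eq_bigr.
Qed.

Lemma free_norm_le (m : free) (K : R) : 0 <= K ->
  (forall f : Lip0 o, `|val m f| <= K * `|f|) -> `|m| <= K.
Proof. by move=> K0 mK; apply: dual_norm_le. Qed.

Lemma free_norm_ge (m : free) (h : M -> R) :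
  (forall x y, `|h x - h y| <= mdist x y) ->
  exists2 f : Lip0 o, forall x, f x = h x - h o & val m f <= `|m|.
Proof.
move=> hL; have [f [fE f1]] := exists_Lip0 o hL; exists f => //.
apply: (le_trans (ler_norm _)); apply: (le_trans (ler_dual_norm _ _)).
by rewrite -[leRHS]mulr1 ler_wpM2l.
Qed.

Lemma free_dense (m : free) (e : R) : 0 < e ->
  exists (n : nat) (a : 'I_n -> R) (x : 'I_n -> M),
    `|m - \sum_i a i *: delta (x i)| < e.
Proof.
move=> e0; have /set_mem m_cl := valP m.
have [w [[n [a [u [u_ev wE]]]]]] := m_cl _ (nbhsx_ballx (val m) e e0).
have /choice[x xu] i : exists y, evaluation o y = u i.
  by have [y _ <-] := u_ev i; exists y.
rewrite -ball_normE /= => mw; exists n, a, x.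
have -> : `|m - \sum_i a i *: delta (x i)| = `|val m - w|.
  rewrite [LHS]/(`|val (m - \sum_i a i *: delta (x i))|) raddfB raddf_sum /= wE.
  by under eq_bigr do rewrite xu.
exact: mw.
Qed.


Lemma normB_delta_le x y : `|delta x - delta y| <= mdist x y.
Proof.
apply: free_norm_le => [|f]; first exact: mdist_ge0.
rewrite mulrC; exact: Lip0_lipschitz.
Qed.

Lemma normB_delta x y : `|delta x - delta y| = mdist x y.
Proof.
apply/eqP; rewrite eq_le normB_delta_le/=.
have [|f fE f_le] := @free_norm_ge (delta x - delta y) (fun z => mdist z y).
  move=> z w; have := metric_triangle z w y; have := metric_triangle w z y.
  by rewrite ler_norml (metric_sym w z); lra.
apply: le_trans f_le; rewrite -[leRHS]/(f x - f y) !fE mdistxx; lra.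
Qed.

End free_space.

Section R_tree_L1.
Context {R : realType} {M T : metricType R} (o : M) (j : M -> T).
Hypothesis T_tree : R_tree T.
Hypothesis j_iso : isometric_embedding j.

Let T4 := R_tree_four_point T_tree.

Lemma R_tree_geodesic : geodesic_space (T := T).
Proof.
move=> a b t tab; have [phi phiP _] := T_tree.1 a b.
by have [] := segment_isometry_between phiP tab; exists (phi t).
Qed.

(** The graph [G] consists of the pairs of a combination of the [delta x] and
    the same combination of the indicators of the segments from the root to
    [j x]. *)
Theorem free_space_of_R_tree_subset_L1 :
  isometric_to_subspace_of_L1 (lipschitz_free o).
Proof.
have [d [X [mu [f f_len]]]] :=
  exists_length_measure (j o) T4 R_tree_geodesic.
pose r := j o.
pose G (u : lipschitz_free o) (g : X -> R) := exists (I : finType) (a : I -> R)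
  (x : I -> M), u = \sum_i a i *: delta o (x i) /\
  g = combination r f [set: I] a (j \o x).
have sumT (I : finType) (F : I -> R) :
    \sum_(i in [set: I]%SET) F i = \sum_i F i.
  by apply: eq_bigl => i; rewrite inE.
apply: (@dense_isometry_extends _ _ _ mu _ G).
- move=> c u g v h [I [a [x [-> ->]]]] [K [b [y [-> ->]]]].
  exists (I + K)%type,
    (fun s => match s with inl i => c * a i | inr k => b k end),
    (fun s => match s with inl i => x i | inr k => y k end); split.
    rewrite big_sumType/= scaler_sumr; congr (_ + _).
    by apply: eq_bigr => i _; rewrite scalerA.
  apply/funext => t; rewrite /combination !sumT big_sumType/= mulr_sumr.
  by congr (_ + _); apply: eq_bigr => i _; rewrite mulrA.
- move=> u g [I [a [x [_ ->]]]]; exact: summable_combination.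
- move=> u g [I [a [x [-> ->]]]]; apply/eqP; rewrite eq_le; apply/andP; split.
    have [h [hr hL <-]] := combination_attained T4 R_tree_geodesic f_len
      [set: I] a (j \o x).
    rewrite sumT.
    have [|f' f'E f'_le] := @free_norm_ge _ _ o
        (\sum_i a i *: delta o (x i)) (h \o j).
      by move=> y z; rewrite -j_iso; exact: hL.
    rewrite free_combinationE in f'_le; apply: le_trans f'_le.
    by apply: ler_sum => i _; rewrite f'E /= hr subr0.
  apply: free_norm_le => [|f']; first exact: L1norm_ge0.
  rewrite free_combinationE.
  have [h [hL hE]] := McShane_extension o j_iso (normr_ge0 f')
    (@Lip0_lipschitz _ _ _ f').
  under eq_bigr do rewrite -hE.
  rewrite -(sumT _ (fun i => a i * h ((j \o x) i))) mulrC.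
  apply: lipschitz_combination_le => //; first exact: R_tree_geodesic.
  by rewrite hE Lip0_origin.
- move=> v e e0; have [n [a [x vx]]] := free_dense v e0.
  exists (\sum_i a i *: delta o (x i)),
    (combination r f [set: 'I_n] a (j \o x)).
  by split=> //; exists 'I_n, a, x.
Qed.

End R_tree_L1.

Lemma addr_pairs (V : zmodType) (x y z w : V) :
  (x + y - (z + w)) + (x + z - (y + w)) = (x - w) *+ 2.
Proof.
rewrite addrACA -opprD (addrACA x y) (addrACA z w) (addrC z y).
by rewrite addrKA opprD addrACA.
Qed.

Section L1_four_point.
Context {R : realType}.

(** Since [`|x + y| + `|x - y| = 2 * max `|x| `|y|], this says that
    [max `|q| `|s| + `|p| <= max `|p| `|q| + max `|p| `|s|]. *)
Lemma ler_six_norms (p q s : R) :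
  `|q + s| + `|q - s| + 2 * `|p| <=
  `|p + q| + `|p - q| + (`|p + s| + `|p - s|).
Proof.
have normE (x y : R) : `|x + y| + `|x - y| = 2 * Num.max `|x| `|y|.
  case: (leP `|x| `|y|) => xy; move: xy.
    by case: (ger0P x); case: (ger0P y); case: (ger0P (x + y));
      case: (ger0P (x - y)) => ? ? ? ? ?; lra.
  by case: (ger0P x); case: (ger0P y); case: (ger0P (x + y));
    case: (ger0P (x - y)) => ? ? ? ? ?; lra.
have [pq qp] : `|p| <= Num.max `|p| `|q| /\ `|q| <= Num.max `|p| `|q|.
  by rewrite !le_max !lexx orbT.
have [ps sp] : `|p| <= Num.max `|p| `|s| /\ `|s| <= Num.max `|p| `|s|.
  by rewrite !le_max !lexx orbT.
by rewrite !normE; case: (leP `|q| `|s|) => _; lra.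
Qed.

Lemma L1_subspace_six_norms (V : normedModType R) :
  isometric_to_subspace_of_L1 V -> forall p q s : V,
  `|q + s| + `|q - s| + 2 * `|p| <=
  `|p + q| + `|p - q| + (`|p + s| + `|p - s|).
Proof.
move=> [d [X [mu [J [J_lin J_norm]]]]] p q s.
have mJ u : measurable_fun setT (J u : X -> R) := LspaceType1_measurable (J u).
have normJ u : (\int[mu]_x (`|J u x|%R)%:E = `|u|%:E)%E.
  by rewrite -J_norm Lnorm1.
have JD u v : J (u + v) = (fun x => J u x + J v x) %[ae mu].
  have := J_lin 1 u v; rewrite scale1r; apply: filterS => x /= Jx _.
  by rewrite Jx// mul1r.
have JB u v : J (u - v) = (fun x => J u x - J v x) %[ae mu].
  have := J_lin (-1) v u; rewrite scaleN1r addrC; apply: filterS => x /= Jx _.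
  by rewrite Jx// mulN1r addrC.
have mN u : measurable_fun setT (fun x => (`|J u x|%R)%:E).
  by apply/measurable_EFinP; exact: measurableT_comp.
have N0 u x : (0 <= (`|J u x|%R)%:E)%E by rewrite lee_fin.
have sumE u v : (\int[mu]_x ((`|J u x|%R)%:E + (`|J v x|%R)%:E) =
    (`|u| + `|v|)%R%:E)%E.
  by rewrite ge0_integralD// !normJ.
rewrite -lee_fin.
have -> : ((`|q + s| + `|q - s| + 2 * `|p|)%:E =
   \int[mu]_x ((`|J (q + s) x|%R)%:E + (`|J (q - s) x|%R)%:E +
     ((`|J p x|%R)%:E + (`|J p x|%R)%:E)))%E.
  rewrite ge0_integralD//; try by move=> *; rewrite adde_ge0.
  - by rewrite !sumE -EFinD mulr_natl mulr2n.
  - exact: emeasurable_funD.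
  - exact: emeasurable_funD.
have -> : ((`|p + q| + `|p - q| + (`|p + s| + `|p - s|))%:E =
   \int[mu]_x ((`|J (p + q) x|%R)%:E + (`|J (p - q) x|%R)%:E +
     ((`|J (p + s) x|%R)%:E + (`|J (p - s) x|%R)%:E)))%E.
  rewrite ge0_integralD//; try by move=> *; rewrite adde_ge0.
  - by rewrite !sumE -EFinD.
  - exact: emeasurable_funD.
  - exact: emeasurable_funD.
apply: ae_ge0_le_integral => //; try by move=> *; rewrite !adde_ge0.
- by apply: emeasurable_funD; exact: emeasurable_funD.
- by apply: emeasurable_funD; exact: emeasurable_funD.
apply: filterS (filterI (JD q s) (filterI (JB q s)
  (filterI (filterI (JD p q) (JB p q)) (filterI (JD p s) (JB p s))))) => x /=.
move=> [/(_ I) -> [/(_ I) -> [[/(_ I) -> /(_ I) ->] [/(_ I) -> /(_ I) ->]]]] _.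
by rewrite -!EFinD lee_fin -mulr2n -mulr_natl; exact: ler_six_norms.
Qed.

Context {M : metricType R} (o : M).

(** Kantorovich duality for two sources [a], [b] and two sinks [c], [d]: the
    test function is the largest 1-Lipschitz function that takes the values [0]
    at [c] and [v] at [d], and [v] is chosen so that the sum of its values at
    [a] and [b], minus [v], is large enough. *)
Lemma norm_two_sources_two_sinks (a b c d : M) :
  Num.min (mdist a c + mdist b d) (mdist a d + mdist b c) <=
  `|delta o a + delta o b - (delta o c + delta o d)|.
Proof.
set m := Num.min _ _.
have [mB mC] : m <= mdist a c + mdist b d /\ m <= mdist a d + mdist b c.
  by rewrite /m !ge_min !lexx orbT.
pose v := Num.max (- mdist c d) (m - mdist a d - mdist b d).
have tri := @metric_triangle R M.
have [v1 v2 v3 v4] : [/\ - mdist c d <= v, m - mdist a d - mdist b d <= v,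
    v <= mdist c d & v <= mdist a c + mdist b c - m].
  have := tri a c d; have := tri b d c; have := tri a d c; have := tri b c d.
  have := mdist_ge0 c d; rewrite (metric_sym d c) /v.
  by rewrite !le_max !ge_max !lexx orbT; split => //; apply/andP; split; lra.
pose h x := Num.min (mdist x c) (mdist x d + v).
have [|f fE f_le] := @free_norm_ge _ _ o
    (delta o a + delta o b - (delta o c + delta o d)) h.
  move=> x y; have := tri x y c; have := tri y x c; have := tri x y d.
  have := tri y x d; rewrite (metric_sym y x) ler_norml /h.
  by case: (leP (mdist x c) (mdist x d + v)) => ?;
    case: (leP (mdist y c) (mdist y d + v)) => ?; lra.
apply: le_trans f_le.
rewrite -[leRHS]/(f a + f b - (f c + f d)) !fE /h !mdistxx.
rewrite add0r (min_l _ : Num.min 0 _ = 0); last by lra.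
rewrite (metric_sym d c) (min_r v3).
by case: (leP (mdist a c) (mdist a d + v)) => ?;
  case: (leP (mdist b c) (mdist b d + v)) => ?; lra.
Qed.

(** The three elements are the signed sums of [a, b, c, d] for the three ways of
    pairing them; the sum and the difference of any two are twice a difference
    of two evaluations. *)
Lemma free_space_subset_L1_four_point :
  isometric_to_subspace_of_L1 (lipschitz_free o) -> four_point_condition M.
Proof.
move=> /L1_subspace_six_norms six a b c d.
pose e x y z w := delta o x + delta o y - (delta o z + delta o w).
have e_def : e a b c d = delta o a + delta o b - (delta o c + delta o d) by [].
have eCl x y z w : e x y z w = e y x z w by rewrite /e (addrC (delta o x)).
have eCr x y z w : e x y z w = e x y w z by rewrite /e (addrC (delta o z)).
have eN x y z w : - e x y z w = e z w x y by rewrite /e opprB.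
have eD x y z w : `|e x y z w + e x z y w| = 2 * mdist x w.
  have -> : e x y z w + e x z y w = (delta o x - delta o w) *+ 2.
    exact: addr_pairs.
  by rewrite normrMn normB_delta mulr_natl.
clearbody e; have := six (e a b c d) (e a c b d) (e a d b c).
have -> : `|e a b c d + e a c b d| = 2 * mdist a d by exact: eD.
have -> : `|e a b c d + e a d b c| = 2 * mdist a c.
  by rewrite (eCr a b); exact: eD.
have -> : `|e a c b d + e a d b c| = 2 * mdist a b.
  by rewrite (eCr a c) (eCr a d); exact: eD.
have -> : `|e a b c d - e a c b d| = 2 * mdist b c.
  by rewrite eN (eCl a b) (eCr b a); exact: eD.
have -> : `|e a b c d - e a d b c| = 2 * mdist b d.
  by rewrite eN (eCl a b); exact: eD.
have -> : `|e a c b d - e a d b c| = 2 * mdist c d.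
  by rewrite eN (eCl a c) (eCl b c); exact: eD.
have := norm_two_sources_two_sinks a b c d; rewrite -e_def le_max ge_min.
by case/orP=> ? ?; apply/orP; lra.
Qed.

End L1_four_point.

Theorem theorem4p2 (R : realType) (M : metricType R) (o : M) :
  (isometric_to_subspace_of_L1 (lipschitz_free o) <-> four_point_condition M) /\
  (four_point_condition M <->
   exists (T : metricType R) (j : M -> T), R_tree T /\ isometric_embedding j).
Proof.
split; split.
- exact: free_space_subset_L1_four_point.
- move=> M4; have [T [j [T_tree j_iso]]] := four_point_embeds_in_R_tree o M4.
  exact: free_space_of_R_tree_subset_L1 T_tree j_iso.
- exact: four_point_embeds_in_R_tree.
- move=> [T [j [T_tree j_iso]]] a b c d; rewrite -!j_iso.
  exact: R_tree_four_point.
Qed.
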